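(* Suppose that a packing of $n$ equal disks in a triangular torus is collectively jammed and that the faces of its packing graph are not all triangles. Assume that either all the faces of the packing graph are rhombi, or the rhombic faces form a single strip and all the other faces are triangles. Then the density $\delta$ of the packing satisfies $$\delta < \frac{n}{n+1}\,\delta_{\Delta} = \frac{n}{n+1}\,\frac{\pi}{\sqrt{12}}.$$
   Context: Identify the Euclidean plane with $\mathbb{C}$. For $g_1,g_2\in\mathbb{C}$ linearly independent over $\mathbb{R}$, let $\Lambda(g_1,g_2)=\{m_1g_1+m_2g_2 : m_1,m_2\in\mathbb{Z}\}$ and $\mathbb{T}^2(\Lambda)=\mathbb{C}/\Lambda$. Put $g_{\Delta}=e^{2\pi i/6}$. A triangular torus is a torus $\mathbb{T}^2(\Lambda(z,g_{\Delta}z))$ with $z\neq 0$. A packing of $n$ equal disks in $\mathbb{T}^2(\Lambda)$ is a collection of $n$ disks of equal radius $r>0$ with disjoint interiors (equivalently, the lifts to the plane of all the disks have pairwise disjoint interiors). Its density is $n\pi r^2$ divided by the area of the torus, and $\delta_{\Delta}=\pi/\sqrt{12}$. A packing is collectively jammed if the only continuous motions of the packing disks through packings, keeping the lattice defining the torus and the common radius fixed, are continuous translations (all disks translated by the same time-dependent vector). The packing graph is obtained by joining the centers of every two tangent packing disks by the straight segment between them. It is considered together with its lift to a periodic graph in the plane, and its faces are the faces of this lifted planar graph modulo the lattice. All edges have length $2r$. In a packing graph the triangular faces are equilateral, and the internal angles of each rhombic face are strictly between $\pi/3$ and $2\pi/3$ (a rhombus with angles $\pi/3,2\pi/3$ is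 subdivided by its short diagonal into two equilateral triangles). A strip of rhombi in a tiling of a torus is a cyclic chain of rhombi in which each rhombus is edge-adjacent to exactly two other rhombi (its neighbors in the chain), and all the lines containing the intersections (common edges) of consecutive rhombi are parallel when lifted to the plane. ''The rhombi form a single strip'' means that the rhombic faces on the torus are exactly the rhombi of one such strip. *)

(* Defs.v *)
(* MathComp-Analysis, with the complex numbers R[i] of mathcomp-real-closed. *)
From HB Require Import structures.
From mathcomp Require Import all_boot all_order all_algebra.
From mathcomp Require Import all_classical all_reals all_analysis.
From mathcomp Require Import complex.

Set Implicit Arguments.
Unset Strict Implicit.
Unset Printing Implicit Defensive.

Import Order.TTheory GRing.Theory Num.Theory numFieldNormedType.Exports.

Local Open Scope classical_set_scope.
Local Open Scope complex_scope.
Local Open Scope ring_scope.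

(* The Euclidean plane: R[i]^o carries the topology of the modulus, whose values
   (and radii of balls) are the elements of R[i] of the form r%:C. *)
Notation plane R := (GRing.regular (complex R)).

Definition gDelta (R : realType) : plane R :=
  cos (2 * pi / 6) +i* sin (2 * pi / 6).

Definition lattice (R : realType) (g1 g2 : plane R) : set (plane R) :=
  [set x | exists m1 m2 : int, x = m1%:~R * g1 + m2%:~R * g2].

Definition torus_area (R : realType) (g1 g2 : plane R) : R :=
  `|complex.Re g1 * complex.Im g2 - complex.Im g1 * complex.Re g2|.

(* A family of n points (or disk centers) of the torus C / L is given by
   arbitrary lifts c i; the lifted centers are the c i + l with l in L. The open
   disk of radius r around x is ball x r%:C. *)
Definition packing (R : realType) (L : set (plane R)) (r : R) (n : nat)
    (c : 'I_n -> plane R) : Prop :=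
  0 < r /\
  trivIset [set il : 'I_n * plane R | L il.2]
           (fun il => ball (c il.1 + il.2) r%:C).

Definition density (R : realType) (g1 g2 : plane R) (r : R) (n : nat) : R :=
  n%:R * pi * r ^+ 2 / torus_area g1 g2.

(* A continuous motion in the torus has a unique continuous lift starting at
   the given lifts of the centers, so motions are described in the plane. *)
Definition motion (R : realType) (L : set (plane R)) (r : R) (n : nat)
    (c : 'I_n -> plane R) (p : 'I_n -> R -> plane R) : Prop :=
  [/\ forall i, {within `[0, 1], continuous (p i)},
      forall i, p i 0 = c i
    & forall t, 0 <= t <= 1 -> packing L r (fun i => p i t)].

Definition collectively_jammed (R : realType) (L : set (plane R)) (r : R)
    (n : nat) (c : 'I_n -> plane R) : Prop :=
  packing L r c /\
  forall p, motion L r c p ->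
    exists2 v : R -> plane R, {within `[0, 1], continuous v} &
      forall i t, 0 <= t <= 1 -> p i t = c i + v t.

Section PackingGraph.
Variables (R : realType) (L : set (plane R)) (r : R) (n : nat).
Variable c : 'I_n -> plane R.
Implicit Types (x y z a b u : plane R) (F P Q : set (plane R)).

Definition vertex x : Prop := exists i, exists2 l, L l & x = c i + l.

(* Two lifted disks of radius r are tangent when their centers are at distance
   2 r; a disk may be tangent to one of its own translates. *)
Definition edge x y : Prop :=
  [/\ vertex x, vertex y & `|x - y| = (2 * r)%:C].

Definition segment x y : set (plane R) :=
  [set w | exists2 t : R, 0 <= t <= 1 & w = (1 - t)%:C * x + t%:C * y].

Definition graph_support : set (plane R) :=
  [set w | vertex w \/ exists x y, edge x y /\ segment x y w].

(* The faces of the lifted graph, as open subsets of the plane; the faces on the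
   torus are their classes under translation by L. *)
Definition face F : Prop :=
  exists2 w, ~ graph_support w & F = connected_component (~` graph_support) w.

Definition open_triangle x y z : set (plane R) :=
  [set w | exists s t q : R, [/\ 0 < s, 0 < t, 0 < q, s + t + q = 1
     & w = s%:C * x + t%:C * y + q%:C * z]].

Definition triangular_face F : Prop :=
  face F /\ exists x y z,
    [/\ edge x y, edge y z, edge z x & F = open_triangle x y z].

Definition open_parallelogram x a b : set (plane R) :=
  [set w | exists s t : R, [/\ 0 < s < 1, 0 < t < 1
     & w = x + s%:C * a + t%:C * b]].

(* The angles are automatically strictly between pi/3 and 2 pi/3: the diagonals
   join distinct vertices, so they have length at least 2 r, and a diagonal of
   length 2 r would be an edge cutting F. *)
Definition rhombic_face F : Prop :=
  face F /\ exists x a b,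
    [/\ edge x (x + a), edge x (x + b), edge (x + a) (x + a + b),
        edge (x + b) (x + a + b) & F = open_parallelogram x a b].

Definition translate_set (l : plane R) F : set (plane R) :=
  [set l + w | w in F].

Definition torus_eq P Q : Prop := exists2 l, L l & P = translate_set l Q.

Definition common_edge P Q x y : Prop :=
  edge x y /\ segment x y `<=` closure P `&` closure Q.

Definition torus_common_edge P Q x y : Prop :=
  exists2 l, L l & common_edge P (translate_set l Q) x y.

(* S lists one lift of each of the k rhombi on the torus. That each of them is
   edge-adjacent to exactly two others amounts to 3 <= k and to the equivalence
   below; ordS is the cyclic successor on 'I_k. *)
Definition strip (k : nat) (S : 'I_k -> set (plane R)) : Prop :=
  [/\ (3 <= k)%N,
      forall i, rhombic_face (S i),
      forall i j, torus_eq (S i) (S j) -> i = j,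
      forall i j, i != j ->
        (exists x y, torus_common_edge (S i) (S j) x y) <->
        (j = ordS i \/ i = ordS j)
    & exists2 u, u != 0 & forall i x y,
        torus_common_edge (S i) (S (ordS i)) x y ->
        exists t : R, y - x = t%:C * u].

Definition all_triangles : Prop := forall F, face F -> triangular_face F.

Definition all_rhombi : Prop := forall F, face F -> rhombic_face F.

Definition single_strip_and_triangles : Prop :=
  (exists k (S : 'I_k -> set (plane R)),
     strip S /\ forall F, rhombic_face F -> exists i, torus_eq F (S i)) /\
  forall F, face F -> rhombic_face F \/ triangular_face F.

End PackingGraph.

(* Main.v *)
(* Put D = (2 r)^2 and let z be the lattice generator; the claim is equivalent to
   (n + 1) D < |z|^2.

   If the vertex set contains a full straight row x + Z a along an edge vector a,
   then, every face being a triangle or a rhombus, all faces on one side of the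
   row are equal to each other, so that the next row is a translate of the
   first, and the whole vertex set consists of rows parallel to a at distance at
   least sqrt 3 / 2 |a|. Let k a be the shortest lattice vector along a and let
   the lattice shift the rows by s: then n <= k s, |z|^2 > k s D as soon as one
   band of rhombi occurs, and k^2 D = nu |z|^2 for an integer nu because the
   lattice is hexagonal. So k > nu s, and k^2 >= k (nu s + 1) > nu (n + 1).

   A straight row exists. If all faces are rhombi, counting the corners of the
   rhombi that contain a fixed direction shows that all vertices have degree 4;
   if opposite edges a, d at some vertex were not aligned, then moving all
   vertices with edges a and d by -(a + d) would lengthen or preserve every
   edge, against jamming. For a single strip in direction u, either u is a
   lattice vector, or the strip is bordered by triangles; these force it to bend
   always to the same side, and, being periodic, not to bend at all. *)
Require Import Defs.
From HB Require Import structures.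
From mathcomp Require Import all_boot all_order all_algebra.
From mathcomp Require Import all_classical all_reals all_analysis.
From mathcomp Require Import complex.
From mathcomp Require Import ring lra zify.

Set Implicit Arguments.
Unset Strict Implicit.
Unset Printing Implicit Defensive.

Import Order.TTheory GRing.Theory Num.Theory numFieldNormedType.Exports.

Local Open Scope classical_set_scope.
Local Open Scope complex_scope.
Local Open Scope ring_scope.

(** * Plane geometry *)

(** Comparing areas alone gives [n * D < |z|^2], a density below that of the triangular lattice. The
    additional [D] comes from arithmetic: [nu], [k] and [s] are integers, so a strict inequality
    between them leaves a gap of at least one. Planarity enters only locally. Since vertices are at
    least [sqrt D] apart, no other edge comes within squared distance [3/16 * D] of the midpoint of
    an edge, so a face is recognised by a single point close to the midpoint of a side. After that
    mostly the vertex set matters: the tip of the face to the left of an edge is unique, because two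
    candidates would make an angle below [pi / 3] and so be closer than [sqrt D]. The degree count
    takes the place of Euler's formula. A fixed direction lies in one corner of each rhombus and in
    at most one corner at each vertex, so there are at most [4 n] directed edges, while angles below
    [2 pi / 3] force at least four at each vertex. First-order motions suffice, because a linear
    motion adds a nonnegative quadratic term to every squared distance. *)

Definition dot (R : realType) (x y : plane R) : R :=
  complex.Re x * complex.Re y + complex.Im x * complex.Im y.

Definition cross (R : realType) (x y : plane R) : R :=
  complex.Re x * complex.Im y - complex.Im x * complex.Re y.

Ltac coords :=
  repeat match goal with v : GRing.regular _ |- _ => destruct v as [? ?] end;
  unfold dot, cross in *; simpl in *.

Section PlaneGeometry.
Variable R : realType.
Implicit Types (a b c d e f x y v w : plane R) (s t D : R).

Lemma dotC x y : dot x y = dot y x.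
Proof. by coords; ring. Qed.

Lemma dotDl x y v : dot (x + y) v = dot x v + dot y v.
Proof. by coords; ring. Qed.

Lemma dotNl x v : dot (- x) v = - dot x v.
Proof. by coords; ring. Qed.

Lemma dotZl t x v : dot (t%:C * x) v = t * dot x v.
Proof. by coords; ring. Qed.

Lemma dotDr x y v : dot v (x + y) = dot v x + dot v y.
Proof. by coords; ring. Qed.

Lemma dotNr x v : dot v (- x) = - dot v x.
Proof. by coords; ring. Qed.

Lemma dotZr t x v : dot v (t%:C * x) = t * dot v x.
Proof. by coords; ring. Qed.

Lemma dot0l x : dot 0 x = 0.
Proof. by coords; ring. Qed.

Lemma crossr0 x : cross x 0 = 0.
Proof. by coords; ring. Qed.

Lemma crossC x y : cross x y = - cross y x.
Proof. by coords; ring. Qed.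

Lemma crossxx x : cross x x = 0.
Proof. by coords; ring. Qed.

Lemma crossDl x y v : cross (x + y) v = cross x v + cross y v.
Proof. by coords; ring. Qed.

Lemma crossNl x v : cross (- x) v = - cross x v.
Proof. by coords; ring. Qed.

Lemma crossZl t x v : cross (t%:C * x) v = t * cross x v.
Proof. by coords; ring. Qed.

Lemma crossDr x y v : cross v (x + y) = cross v x + cross v y.
Proof. by coords; ring. Qed.

Lemma crossNr x v : cross v (- x) = - cross v x.
Proof. by coords; ring. Qed.

Lemma crossZr t x v : cross v (t%:C * x) = t * cross v x.
Proof. by coords; ring. Qed.

Definition bilinE := (dotDl, dotNl, dotZl, dotDr, dotNr, dotZr,
  crossDl, crossNl, crossZl, crossDr, crossNr, crossZr, crossxx).

(** As [conj a * b = dot a b + i * cross a b], this and [gram_cross] are the real and imaginary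
    parts of [|a|^2 * (conj b * c) = conj (conj a * b) * (conj a * c)]. *)
Lemma gram a b c : dot a a * dot b c = dot a b * dot a c + cross a b * cross a c.
Proof. by coords; ring. Qed.

Lemma lagrange a b : dot a a * dot b b = dot a b ^+ 2 + cross a b ^+ 2.
Proof. by rewrite gram !expr2. Qed.

Lemma gram_cross a b c :
  dot a a * cross b c = dot a b * cross a c - cross a b * dot a c.
Proof. by coords; ring. Qed.

Lemma plucker a b c d :
  cross a b * cross c d + cross b c * cross a d + cross c a * cross b d = 0.
Proof. by coords; ring. Qed.

Lemma dot_ge0 a : 0 <= dot a a.
Proof. by rewrite /dot -!expr2 addr_ge0 ?sqr_ge0. Qed.

Lemma dot_eq0 a : (dot a a == 0) = (a == 0).
Proof.
rewrite /dot -!expr2 paddr_eq0 ?sqr_ge0 // !sqrf_eq0.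
by case: a => a1 a2 /=; rewrite eq_complex.
Qed.

Lemma eq_dot_cross a b c : a != 0 -> dot a b = dot a c -> cross a b = cross a c ->
  b = c.
Proof.
rewrite -dot_eq0 => a0 h1 h2; apply/eqP; rewrite -subr_eq0 -dot_eq0.
have := gram a (b - c) (b - c); rewrite !bilinE h1 h2 !subrr !mul0r addr0.
by move/eqP; rewrite mulf_eq0 (negbTE a0).
Qed.

Lemma norm_diff a b : dot (a - b) (a - b) = dot a a + dot b b - 2 * dot a b.
Proof. by rewrite !bilinE (dotC b a); ring. Qed.

Lemma norm_sum a b : dot (a + b) (a + b) = dot a a + dot b b + 2 * dot a b.
Proof. by rewrite !bilinE (dotC b a); ring. Qed.

(** The parallelogram law for [a + b] and [a], with the square of their sum dropped. *)
Lemma norm_le_sum a b : dot b b <= 2 * dot (a + b) (a + b) + 2 * dot a a.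
Proof.
by have := dot_ge0 (a + a + b); rewrite !bilinE (dotC b a); lra.
Qed.

Lemma norm_combo t a b :
  dot ((1 - t)%:C * a + t%:C * b) ((1 - t)%:C * a + t%:C * b) =
  (1 - t) * dot a a + t * dot b b - t * (1 - t) * dot (a - b) (a - b).
Proof. by rewrite norm_diff !bilinE (dotC b a); ring. Qed.

(** Cramer's rule; these are the coordinates used below for parallelograms, triangles and
    corners. *)
Lemma coordE a b x : cross a b != 0 ->
  x = (cross x b / cross a b)%:C * a + (cross a x / cross a b)%:C * b.
Proof.
move=> ab0; have a0 : a != 0.
  by apply: contraNneq ab0 => ->; rewrite -[0](subrr b) crossDl crossNl subrr.
apply: (eq_dot_cross a0); rewrite !bilinE; last by field.
apply: (mulfI ab0); move: (ab0); coords => ?.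
by field.
Qed.

(* For the uniform corner of a parallelogram with independent coordinates, the
   mean squared distance to the point is [s (1 - s) |a|^2 + t (1 - t) |b|^2]. *)
Lemma near_corner D a b s t : dot a a = D -> dot b b = D -> 0 < D ->
  0 <= s <= 1 -> 0 <= t <= 1 ->
  let v := s%:C * a + t%:C * b in
  [\/ dot v v < D, dot (v - a) (v - a) < D, dot (v - b) (v - b) < D |
      dot (v - a - b) (v - a - b) < D].
Proof.
move=> aD bD D0 s01 t01 v.
have [h|h1] := ltP (dot v v) D; first by constructor 1.
have [h|h2] := ltP (dot (v - a) (v - a)) D; first by constructor 2.
have [h|h3] := ltP (dot (v - b) (v - b)) D; first by constructor 3.
have [h|h4] := ltP (dot (v - a - b) (v - a - b)) D; first by constructor 4.
exfalso; move: h1 h2 h3 h4; rewrite /v !bilinE (dotC b a) aD bD.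
move: (dot a b) => c h1 h2 h3 h4.
have p1 : 0 <= (1 - s) * (1 - t) by rewrite mulr_ge0; lra.
have p2 : 0 <= s * (1 - t) by rewrite mulr_ge0; lra.
have p3 : 0 <= (1 - s) * t by rewrite mulr_ge0; lra.
have p4 : 0 <= s * t by rewrite mulr_ge0; lra.
have := lerD (lerD (ler_wpM2l p1 h1) (ler_wpM2l p2 h2))
             (lerD (ler_wpM2l p3 h3) (ler_wpM2l p4 h4)).
have q1 : s * (1 - s) <= 1/4 by nra.
have q2 : t * (1 - t) <= 1/4 by nra.
nra.
Qed.

End PlaneGeometry.

(** * Uniqueness of the face to the left of an edge; rows of vertices *)

Section Rhombs.
Variables (R : realType) (D : R).
Hypothesis D_gt0 : 0 < D.
Implicit Types (a b c d e f x y v w : plane R).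

(** The bound on the dot product puts the angle strictly between [pi / 3] and [2 pi / 3]; the sign
    of [cross] puts the rhombus to the left of [a]. *)
Definition rhomb a b : Prop :=
  [/\ dot a a = D, dot b b = D, 0 < cross a b & `|dot a b| < D / 2].

Definition trigon a b : Prop :=
  [/\ dot a a = D, dot b b = D, 0 < cross a b & dot a b = D / 2].

Lemma cross_neq0 a b : dot a a = D -> dot b b = D -> a <> b -> a <> - b ->
  cross a b != 0.
Proof.
move=> aD bD ab aNb; apply/eqP => X0.
have := lagrange a b; rewrite aD bD X0 expr0n addr0 -expr2 => /eqP.
rewrite eqf_sqr => /orP[] /eqP h.
  by apply: ab; apply/eqP; rewrite -subr_eq0 -dot_eq0 norm_diff aD bD -h; apply/eqP; ring.
by apply: aNb; apply/eqP; rewrite -subr_eq0 -dot_eq0 opprK norm_sum aD bD h; apply/eqP; ring.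
Qed.

(** Two sines that are at least [sqrt 3 / 2], one of them strictly, have a product above [3 / 4];
    squares keep the root out. *)
Lemma heights_prod (X Y : R) : 0 < X -> 0 < Y ->
  3 / 4 * D ^+ 2 < X ^+ 2 -> 3 / 4 * D ^+ 2 <= Y ^+ 2 -> 3 / 4 * D ^+ 2 < X * Y.
Proof.
move=> X0 Y0 XX YY; have D0 := D_gt0.
have d2 : 0 < D ^+ 2 by rewrite exprn_gt0.
have h : (3 / 4 * D ^+ 2) * (3 / 4 * D ^+ 2) < X ^+ 2 * Y ^+ 2 by nra.
have XY0 : 0 < X * Y by rewrite mulr_gt0.
by rewrite ltNge; apply/negP => h'; nra.
Qed.

(** Two directions on the same side of [a], both at angles between [pi / 3] and [2 pi / 3] from it,
    are less than [pi / 3] apart: in [gram] the product of the cosines exceeds [-1/4] and that of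
    the sines [3/4]. *)
Lemma acute_angle a b c : dot a a = D -> dot b b = D -> dot c c = D ->
  0 < cross a b -> 0 < cross a c -> `|dot a b| < D / 2 -> `|dot a c| <= D / 2 ->
  D / 2 < dot b c.
Proof.
move=> aD bD cD; move: (gram a b c) (lagrange a b) (lagrange a c).
rewrite aD bD cD; move: (dot b c) (dot a b) (dot a c) (cross a b) (cross a c).
move=> u p q X Y h1 h2 h3 X0 Y0; rewrite ltr_norml ler_norml => /andP[p1 p2] /andP[q1 q2].
have D0 := D_gt0.
have XX : 3 / 4 * D ^+ 2 < X ^+ 2 by nra.
have YY : 3 / 4 * D ^+ 2 <= Y ^+ 2 by nra.
have XY := heights_prod X0 Y0 XX YY.
have pq : - (D ^+ 2 / 4) < p * q by nra.
rewrite -(ltr_pM2l D0) h1; nra.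
Qed.

Lemma rhomb_close a b c : rhomb a b -> rhomb a c -> dot (b - c) (b - c) < D.
Proof.
move=> [aD bD X p] [_ cD Y q].
have := acute_angle aD bD cD X Y p (ltW q).
by rewrite norm_diff bD cD; lra.
Qed.

Lemma rhomb_trigon_close a b c : rhomb a b -> trigon a c -> dot (b - c) (b - c) < D.
Proof.
move=> [aD bD X p] [_ cD Y q].
have q' : `|dot a c| <= D / 2 by rewrite q ger0_norm // divr_ge0 // ltW.
have := acute_angle aD bD cD X Y p q'.
by rewrite norm_diff bD cD; lra.
Qed.

Lemma trigon_turn a b : trigon a b ->
  [/\ dot (b - a) (b - a) = D, cross a (b - a) = cross a b & dot a (b - a) = - (D / 2)].
Proof.
move=> [aD bD X p]; rewrite norm_diff (dotC b) !bilinE aD bD p.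
by split; lra.
Qed.

(** Seen from the end of [a], the apex of the triangle is [c - a], at angle [2 pi / 3] with [a]; it
    is compared with a rhombus side starting there. *)
Lemma rhomb_trigon_close' a b c : rhomb a b -> trigon a c ->
  dot (b - (c - a)) (b - (c - a)) < D.
Proof.
move=> [aD bD X p] t; have [cD Y q] := trigon_turn t.
have q' : `|dot a (c - a)| <= D / 2.
  by rewrite q normrN ger0_norm // divr_ge0 // ltW.
have Y' : 0 < cross a (c - a) by rewrite Y; case: t.
have := acute_angle aD bD cD X Y' p q'.
by rewrite norm_diff bD cD; lra.
Qed.

Lemma norm_neq0 a : dot a a = D -> a != 0.
Proof. by move=> aD; rewrite -dot_eq0 aD gt_eqF. Qed.

Lemma trigon_inj a b c : trigon a b -> trigon a c -> b = c.
Proof.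
move=> [aD bD X p] [_ cD Y q]; apply: (@eq_dot_cross _ a); first exact: norm_neq0.
  by rewrite p q.
have := lagrange a b; have := lagrange a c; rewrite aD bD cD p q => -> /addrI /eqP.
by rewrite eqf_sqr => /orP[/eqP ->//|/eqP]; lra.
Qed.

Lemma rhomb_not_trigon a b : rhomb a b -> trigon a b -> False.
Proof.
move=> [_ _ _ p] [_ _ _ q]; move: p; rewrite q ger0_norm ?ltxx //.
by rewrite divr_ge0 // ltW.
Qed.

Lemma rhomb_height a b : rhomb a b -> 3 / 4 * D ^+ 2 < cross a b ^+ 2.
Proof.
move=> [aD bD X]; rewrite ltr_norml => /andP[p q].
have := lagrange a b; rewrite aD bD => h; have D0 := D_gt0; nra.
Qed.

Lemma trigon_height a b : trigon a b -> cross a b ^+ 2 = 3 / 4 * D ^+ 2.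
Proof.
by move=> [aD bD X p]; have := lagrange a b; rewrite aD bD p => h; lra.
Qed.

Variable V : set (plane R).
Hypothesis V_sep : forall x y, V x -> V y -> dot (x - y) (x - y) < D -> x = y.

Lemma V_sepD x b c : V (x + b) -> V (x + c) -> dot (b - c) (b - c) < D -> b = c.
Proof.
move=> vb vc h; apply: (@addrI _ x); apply: V_sep => //.
by have -> : x + b - (x + c) = b - c by ring.
Qed.

(** What remains of the assumption on the faces once the topology is discharged; [vertex_left] and
    [rhombi_bound] supply it. *)
Hypothesis V_left : forall x a, V x -> V (x + a) -> dot a a = D ->
  (exists b, [/\ rhomb a b, V (x + b) & V (x + a + b)]) \/
  (exists b, trigon a b /\ V (x + b)).

(** For a triangle the face on the next edge decides, hence the third row vertex. A rhombus there
    would have a side too close to [b - a], which makes the angle [2 pi / 3] with [a]. *)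
Lemma row_next a x b : V x -> V (x + a) -> V (x + a + a) ->
  rhomb a b \/ trigon a b -> V (x + b) -> V (x + a + b).
Proof.
move=> vx vxa vxaa tb vxb.
have aD : dot a a = D by case: tb => [[]|[]].
case: tb => tb.
  case: (V_left vx vxa aD) => [[c [tc vc vac]]|[c [tc vc]]].
    by rewrite (V_sepD vxb vc (rhomb_close tb tc)).
  by move: (rhomb_not_trigon tb); rewrite (V_sepD vxb vc (rhomb_trigon_close tb tc)) => /(_ tc).
case: (V_left vxa vxaa aD) => [[c [tc vc vac]]|[c [tc vc]]]; last first.
  by rewrite (trigon_inj tb tc).
have vb : V (x + a + (b - a)) by have -> : x + a + (b - a) = x + b by ring.
have ec := V_sepD vc vb (rhomb_trigon_close' tc tb).
have [_ _ q] := trigon_turn tb.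
case: tc => _ _ _; rewrite ec q normrN ger0_norm ?ltxx //.
by rewrite divr_ge0 // ltW.
Qed.

(** The converse propagation, for negative indices; here the face on the edge from [x] decides in
    both cases. *)
Lemma row_prev a x b : V x -> V (x + a) ->
  rhomb a b \/ trigon a b -> V (x + a + b) -> V (x + b).
Proof.
move=> vx vxa tb vxb.
have aD : dot a a = D by case: tb => [[]|[]].
case: (V_left vx vxa aD) => [[c [tc vc vac]]|[c [tc vc]]].
- case: tb => tb; first by rewrite (V_sepD vxb vac (rhomb_close tb tc)).
  have ec := V_sepD vac vxb (rhomb_trigon_close tc tb).
  by case: (rhomb_not_trigon tc); rewrite ec.
- case: tb => tb; last by rewrite (trigon_inj tb tc).
  have vb : V (x + a + (c - a)) by have -> : x + a + (c - a) = x + c by ring.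
  have ec := V_sepD vxb vb (rhomb_trigon_close' tb tc).
  have [_ _ q] := trigon_turn tc.
  case: tb => _ _ _; rewrite ec q normrN ger0_norm ?ltxx //.
  by rewrite divr_ge0 // ltW.
Qed.

Definition row a x : Prop := forall m : int, V (x + (m%:~R)%:C * a).

Lemma row_step a x b : row a x -> rhomb a b \/ trigon a b -> V (x + b) ->
  row a (x + b).
Proof.
move=> ra tb vb.
have E (m : int) : x + ((m + 1)%:~R)%:C * a = x + (m%:~R)%:C * a + a.
  by rewrite rmorphD /= rmorphD /=; ring.
have E2 (m : int) : x + (m%:~R)%:C * a + a + b = x + b + ((m + 1)%:~R)%:C * a.
  by rewrite rmorphD /= rmorphD /=; ring.
elim/int_rect => [|m IH|m IH]; first by rewrite mul0r addr0.
- have -> : (m.+1 : int) = (m : int) + 1 by lia.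
  rewrite -E2; apply: row_next => //; rewrite -?E //.
  by have -> : x + (m%:~R)%:C * a + b = x + b + (m%:~R)%:C * a by ring.
- have := IH; have {1}-> : (- (m : int)) = - (m.+1 : int) + 1 by lia.
  rewrite -E2 => h.
  have -> : x + b + ((- (m.+1 : int))%:~R)%:C * a = x + ((- (m.+1 : int))%:~R)%:C * a + b.
    by ring.
  by apply: (@row_prev a) => //; rewrite -E.
Qed.

Lemma row_exists_step a x : dot a a = D -> row a x ->
  exists b, [/\ rhomb a b \/ trigon a b & V (x + b)].
Proof.
move=> aD ra.
have v0 : V x by have := ra 0; rewrite mul0r addr0.
have v1 : V (x + a) by have := ra 1; rewrite mul1r.
case: (V_left v0 v1 aD) => [[c [tc vc vac]]|[c [tc vc]]]; exists c; split; auto.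
Qed.

Lemma row_line a x t : dot a a = D -> row a x -> V (x + t%:C * a) ->
  exists m : int, t = m%:~R.
Proof.
move=> aD ra vt; exists (Num.floor t).
have := floor_itv t => /andP[f1 f2].
rewrite intrD in f2.
have := V_sepD vt (ra (Num.floor t)).
have -> : t%:C * a - ((Num.floor t)%:~R)%:C * a = (t - (Num.floor t)%:~R)%:C * a.
  by rewrite rmorphB /= ; ring.
rewrite dotZl dotZr aD => h; have {h} : t%:C * a = ((Num.floor t)%:~R)%:C * a.
  apply: h; set u := (_ - _).
  have u0 : 0 <= u by rewrite /u; lra.
  have u1 : u < 1 by rewrite /u; lra.
  have D0 := D_gt0; have h1 : u * D <= D by nra.
  nra.
move/(congr1 (dot a)); rewrite !bilinE aD => /mulIf; apply.
by rewrite gt_eqF.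
Qed.

(** The band is cut into parallelograms. By [near_corner] a vertex in one of them coincides with a
    corner, and the half-open condition excludes the two upper corners. *)
Lemma row_band a x b y : row a x -> row a (x + b) -> rhomb a b \/ trigon a b ->
  V y -> 0 <= cross a (y - x) < cross a b -> exists m : int, y = x + (m%:~R)%:C * a.
Proof.
move=> r1 r2 tb vy /andP[h1 h2].
have aD : dot a a = D by case: tb => [[]|[]].
have bD : dot b b = D by case: tb => [[]|[]].
have X0 : 0 < cross a b by case: tb => [[]|[]].
have Xn : cross a b != 0 by rewrite gt_eqF.
have := coordE (y - x) Xn; set s := _ / _; set t := _ / _ => yE.
have t01 : 0 <= t < 1 by rewrite /t divr_ge0 ?ltr_pdivrMr ?mul1r // ltW.
have := floor_itv s; rewrite intrD => /andP[f1 f2]; set m := Num.floor s in f1 f2.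
set w := (s - m%:~R)%:C * a + t%:C * b.
have s01 : 0 <= s - m%:~R < 1 by lra.
have wE : y = x + (m%:~R)%:C * a + w.
  rewrite /w rmorphB /=; have -> : y = x + (y - x) by ring.
  by rewrite yE; ring.
have Cw : cross a w = cross a (y - x) by rewrite wE !bilinE; ring.
move: vy; rewrite wE => vy.
have E1 : x + (m%:~R)%:C * a + a = x + ((m + 1)%:~R)%:C * a.
  by rewrite intrD rmorphD /=; ring.
have s01' : 0 <= s - m%:~R <= 1 by lra.
have t01' : 0 <= t <= 1 by lra.
case: (near_corner aD bD D_gt0 s01' t01'); rewrite -/w => h.
- exists m; have w0 : w = 0.
    apply: (V_sepD vy (c := 0)); rewrite ?subr0 //.
    by rewrite addr0; apply: r1.
  by rewrite w0 addr0.
- exists (m + 1); rewrite -E1; congr (_ + _).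
  by apply: (V_sepD vy) => //; rewrite E1; apply: r1.
- exfalso; have e : w = b.
    apply: (V_sepD vy) => //.
    have -> : x + (m%:~R)%:C * a + b = x + b + (m%:~R)%:C * a by ring.
    exact: r2.
  by move: h2; rewrite -Cw e ltxx.
- exfalso; have e : w = a + b.
    apply: (V_sepD vy); last by have -> : w - (a + b) = w - a - b by ring.
    have -> : x + (m%:~R)%:C * a + (a + b) = x + b + ((m + 1)%:~R)%:C * a.
      by rewrite intrD rmorphD /=; ring.
    exact: r2.
  by move: h2; rewrite -Cw e !bilinE add0r ltxx.
Qed.

End Rhombs.

(** * The hexagonal lattice *)

Section Lattice.
Variable R : realType.
Implicit Types (a b c d e f x y v w z : plane R).

Lemma gDeltaE : [/\ complex.Re (gDelta R) = 1 / 2 :> R, 0 < complex.Im (gDelta R) :> R &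
  complex.Im (gDelta R) ^+ 2 = 3 / 4 :> R].
Proof.
rewrite /gDelta /=; set t : R := 2 * pi / 6.
have pi0 := @pi_gt0 R.
have t3 : t + t + t = pi by rewrite /t; field.
have c0 : 0 < cos t by apply: cos_gt0_pihalf; rewrite /t; lra.
have s0 : 0 < sin t by apply: sin_gt0_pi; rewrite /t; lra.
have h := @cospi R; rewrite -t3 !cosD sinD in h.
have cs := cos2Dsin2 t.
have c12 : cos t = 1 / 2.
  (* The triple angle formula turns [cos (3 t) = -1] into [4 c^3 - 3 c + 1 = 0], which factors in
     this way. *)
  have e : (cos t + 1) * (2 * cos t - 1) ^+ 2 = 0.
    have -> : (cos t + 1) * (2 * cos t - 1) ^+ 2 = 4 * cos t ^+ 3 - 3 * cos t + 1 by ring.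
    have s2 : sin t ^+ 2 = 1 - cos t ^+ 2 by lra.
    transitivity ((cos t * cos t - sin t * sin t) * cos t -
      (sin t * cos t + cos t * sin t) * sin t + 1); last by rewrite h; ring.
    have -> : (cos t * cos t - sin t * sin t) * cos t -
      (sin t * cos t + cos t * sin t) * sin t + 1 =
      cos t ^+ 3 - 3 * cos t * sin t ^+ 2 + 1 by ring.
    by rewrite s2; ring.
  by move: e => /eqP; rewrite mulf_eq0 sqrf_eq0 => /orP[] /eqP e; lra.
by split => //; rewrite c12 in cs; lra.
Qed.

Definition hex z : set (plane R) := lattice z (gDelta R * z).

Lemma intC (m : int) : (m%:~R : plane R) = (m%:~R : R)%:C :> R[i].
Proof. by rewrite rmorph_int. Qed.

Lemma hex0 z : hex z 0.
Proof. by exists 0, 0; rewrite !mul0r addr0. Qed.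

Lemma hexD z x y : hex z x -> hex z y -> hex z (x + y).
Proof.
move=> [m1 [m2 ->]] [n1 [n2 ->]]; exists (m1 + n1), (m2 + n2).
by rewrite !intrD; ring.
Qed.

Lemma hexN z x : hex z x -> hex z (- x).
Proof.
move=> [m1 [m2 ->]]; exists (- m1), (- m2); rewrite !rmorphN; ring.
Qed.

Lemma hexB z x y : hex z x -> hex z y -> hex z (x - y).
Proof. by move=> hx hy; apply: hexD => //; apply: hexN. Qed.

Lemma hexMz z x (m : int) : hex z x -> hex z ((m%:~R)%:C * x).
Proof.
move=> [m1 [m2 ->]]; exists (m * m1), (m * m2).
by rewrite -intC !intrM; ring.
Qed.

Lemma cross_gDelta z : cross z (gDelta R * z) = complex.Im (gDelta R) * dot z z.
Proof. by move: (gDelta R) => g; coords; ring. Qed.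

Lemma dot_gDelta z : dot z (gDelta R * z) = dot z z / 2.
Proof.
have [g1 _ _] := gDeltaE.
have -> : dot z z / 2 = complex.Re (gDelta R) * dot z z by rewrite g1; lra.
by move: (gDelta R) {g1} => g; coords; ring.
Qed.

Lemma norm_gDelta z : dot (gDelta R * z) (gDelta R * z) = dot z z.
Proof.
have [g1 _ g2] := gDeltaE.
have -> : dot (gDelta R * z) (gDelta R * z) =
  (complex.Re (gDelta R) ^+ 2 + complex.Im (gDelta R) ^+ 2) * dot z z.
  by move: (gDelta R) {g1 g2} => g; coords; ring.
by rewrite g1 g2; lra.
Qed.

(** The integer factor is the norm form of the Eisenstein integers; it is the source of [nu]. *)
Lemma norm_hex z (m1 m2 : int) :
  let x := m1%:~R * z + m2%:~R * (gDelta R * z) in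
  dot x x = (m1 ^+ 2 + m1 * m2 + m2 ^+ 2)%:~R * dot z z.
Proof.
rewrite /= !intC !bilinE norm_gDelta (dotC _ z) dot_gDelta !rmorphD !rmorphXn rmorphM /=.
by field.
Qed.

Lemma cross_hex z (m1 m2 n1 n2 : int) :
  cross (m1%:~R * z + m2%:~R * (gDelta R * z)) (n1%:~R * z + n2%:~R * (gDelta R * z)) =
  (m1 * n2 - m2 * n1)%:~R * (complex.Im (gDelta R) * dot z z).
Proof.
rewrite !intC !bilinE (crossC _ z) cross_gDelta rmorphB !rmorphM /=.
by ring.
Qed.

(** Dividing the coefficients by their gcd gives [q], and Bezout coefficients give an [l] that
    completes [q] to a positively oriented basis of the lattice. *)
Lemma hex_primitive z p : p != 0 -> hex z p ->
  exists (d : nat) q l, [/\ (0 < d)%N, p = d%:R%:C * q, hex z q, hex z l &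
     cross q l = complex.Im (gDelta R) * dot z z].
Proof.
move=> p0 [m1 [m2 pE]].
have [u1 [u2 [w1 [w2 [m1E m2E wE]]]]] : exists u1 u2 w1 w2 : int,
    [/\ m1 = gcdz m1 m2 * u1, m2 = gcdz m1 m2 * u2 & u1 * w2 - u2 * w1 = 1].
  have g0 : gcdz m1 m2 != 0.
    rewrite gcdz_eq0; apply: contraNN p0 => /andP[/eqP h1 /eqP h2].
    by rewrite pE h1 h2 !mul0r addr0.
  have /dvdzP[u1 u1E] := dvdz_gcdl m1 m2; have /dvdzP[u2 u2E] := dvdz_gcdr m1 m2.
  have [x1 [x2 h]] := Bezoutz m1 m2.
  exists u1, u2, (- x2), x1; split; rewrite 1?(mulrC (gcdz _ _)) //.
  apply: (mulfI g0); rewrite mulr1; transitivity (x1 * m1 + x2 * m2); last by [].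
  rewrite {2}u1E {3}u2E; ring.
have d0 : gcdz m1 m2 != 0.
  apply: contraNneq p0 => h; have h1 : m1 = 0 by rewrite m1E h mul0r.
  have h2 : m2 = 0 by rewrite m2E h mul0r.
  by rewrite pE h1 h2 !mul0r addr0.
exists `|gcdz m1 m2|%N, (u1%:~R * z + u2%:~R * (gDelta R * z)),
  (w1%:~R * z + w2%:~R * (gDelta R * z)); split.
- by rewrite absz_gt0.
- have -> : (`|gcdz m1 m2|%:R : R) = (gcdz m1 m2)%:~R by rewrite -[gcdz m1 m2 in RHS]gez0_abs.
  have -> : p = (gcdz m1 m2 * u1)%:~R * z + (gcdz m1 m2 * u2)%:~R * (gDelta R * z).
    by rewrite -m1E -m2E.
  by rewrite !intrM -intC; ring.
- by exists u1, u2.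
- by exists w1, w2.
- by rewrite cross_hex /= wE mul1r.
Qed.

End Lattice.

(** * Density of a vertex set with a straight row *)

Section RowDensity.
Variables (R : realType) (D : R) (z : plane R) (n : nat) (c : 'I_n -> plane R).
Hypothesis D_gt0 : 0 < D.
Implicit Types (a b d e f x y v w : plane R).

Let V : set (plane R) := vertex (hex z) c.

Hypothesis V_sep : forall x y, V x -> V y -> dot (x - y) (x - y) < D -> x = y.
Hypothesis c_inj : forall i j l, hex z l -> c i = c j + l -> i = j.
Hypothesis V_left : forall x a, V x -> V (x + a) -> dot a a = D ->
  (exists b, [/\ rhomb D a b, V (x + b) & V (x + a + b)]) \/
  (exists b, trigon D a b /\ V (x + b)).

Lemma vertexD x l : V x -> hex z l -> V (x + l).
Proof.
move=> [i [l' hl' ->]] hl; exists i; exists (l' + l); first exact: hexD.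
by rewrite addrA.
Qed.

(** An index [m] is raised to [m + |m| K], which is nonnegative, and then translated back by [|m|]
    periods. *)
Lemma periodic_row a x (K : nat) : (0 < K)%N -> hex z (K%:R%:C * a) ->
  (forall j : nat, V (x + j%:R%:C * a)) -> row V a x.
Proof.
move=> K0 hK hx m.
have := vertexD (hx (absz (m + (absz m * K)%N%:Z))) (hexMz (- (absz m)%:Z) hK).
set y := _ + _ + _; suff -> : y = x + (m%:~R)%:C * a by [].
have e : ((absz (m + (absz m * K)%N%:Z))%:R : R) = m%:~R + (absz m)%:R * K%:R.
  have h : 0 <= m + (absz m * K)%N%:Z by nia.
  transitivity ((absz (m + (absz m * K)%N%:Z))%:Z%:~R : R) => //.
  by rewrite gez0_abs // intrD -natrM.
rewrite /y e rmorphD rmorphN rmorphM /=; rewrite rmorphN /=; ring.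
Qed.

Lemma between (H : nat -> R) (N : nat) (t : R) : H 0%N <= t -> t < H N ->
  exists2 q, (q < N)%N & H q <= t < H q.+1.
Proof.
move=> h0; elim: N => [|N IH] hN; first by move: (le_lt_trans h0 hN); rewrite ltxx.
have [h|h] := ltP t (H N); last by exists N => //; rewrite h.
by have [q qN hq] := IH h; exists q => //; rewrite ltnW.
Qed.

(** Rows are built to the left only. The first step is prescribed to be the rhombus side [b], which
    later makes the total height strict. *)
Lemma row_sequence a b x : rhomb D a b -> V (x + b) -> row V a x ->
  exists xs : nat -> plane R, exists bs : nat -> plane R,
   [/\ xs 0%N = x, bs 0%N = b,
    forall q, xs q.+1 = xs q + bs q,
    forall q, rhomb D a (bs q) \/ trigon D a (bs q) &
    forall q, row V a (xs q)].
Proof.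
move=> ab vb rx; have aD : dot a a = D by case: ab.
have /choice[st stP] : forall y, exists e, row V a y ->
   [/\ rhomb D a e \/ trigon D a e, V (y + e) & y = x -> e = b].
  move=> y; have [ry|nry] := pselect (row V a y); last by exists 0.
  have [yx|yx] := eqVneq y x; first by exists b => _; rewrite yx; split; auto.
  have [e [te ve]] := row_exists_step V_left aD ry.
  by exists e => _; split => // yx'; rewrite yx' eqxx in yx.
pose xs q := iter q (fun y => y + st y) x.
have rxs q : row V a (xs q).
  elim: q => [//|q IH] /=; have [te ve _] := stP _ IH.
  by apply: (row_step D_gt0 V_sep V_left).
exists xs, (fun q => st (xs q)); split => //.
- by have [_ _ ->] := stP _ rx.
- by move=> q; have [] := stP _ (rxs q).
Qed.

(** The integer gap behind [n + 1]: cancelling [k] gives [nu * s + 1 <= k], and [nu < k] makes the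
    final comparison strict. *)
Lemma gap_step (nu s k m : nat) : (0 < nu)%N -> (0 < s)%N ->
  (nu * (s * k) < k * k)%N -> (m <= s * k)%N -> (nu * (m + 1) < k * k)%N.
Proof.
move=> nu0 s0 h hm; have k3 : (nu * s < k)%N by nia.
apply: (@leq_ltn_trans (nu * (s * k + 1))%N); first by rewrite leq_mul2l leq_add2r hm orbT.
have : (k * (nu * s + 1) <= k * k)%N by rewrite leq_mul2l addn1 k3 orbT.
nia.
Qed.

(** Here [K] is any period of the row, as the pigeonhole principle delivers it; the proof passes to
    the shortest one, [k]. *)
Lemma row_density a b x (K : nat) : (0 < K)%N -> hex z (K%:R%:C * a) ->
  (forall j : nat, V (x + j%:R%:C * a)) -> rhomb D a b -> V (x + b) ->
  (n%:R + 1) * D < dot z z.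
Proof.
move=> K0 hK hx ab vb.
have rx := periodic_row K0 hK hx.
have [aD bD X0 p] := ab.
have a0 : a != 0 by apply: (norm_neq0 D_gt0 aD).
have vx : V x by have := rx 0; rewrite mul0r addr0.
have KR : (K%:R : R) != 0 by rewrite pnatr_eq0 -lt0n.
have Ka0 : K%:R%:C * a != 0.
  rewrite mulf_neq0 //; apply: contra KR => /eqP h.
  by have := congr1 (@complex.Re R) h => /= ->.
have [d [q [l [d0 qE hq hl ql]]]] := hex_primitive Ka0 hK.
have dR : (d%:R : R) != 0 by rewrite pnatr_eq0 -lt0n.
have qa : q = (K%:R / d%:R)%:C * a.
  have dC : (d%:R : R)%:C != 0 :> plane R.
    by apply: contra dR => /eqP h; have := congr1 (@complex.Re R) h => /= ->.
  apply: (mulfI dC); rewrite -qE mulrA -rmorphM /=.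
  by congr (_%:C * _); field.
(* The translate of [x] by the primitive vector [q] is a vertex on the row, so [q] is an integer
   multiple of [a]. *)
have [k kE] : exists k : int, K%:R / d%:R = k%:~R :> R.
  apply: (row_line D_gt0 V_sep aD rx); rewrite -qa; exact: vertexD.
have k0 : 0 < k.
  by rewrite -(ltr0z R) -kE divr_gt0 // ltr0n.
case: k kE k0 => // k kE k0.
have {}qa : q = (k%:R)%:C * a by rewrite qa kE.
have kR : 0 < k%:R :> R by rewrite ltr0n.
have [g1 g2 g3] := gDeltaE R.
set s3 := complex.Im (gDelta R) in ql g2 g3.
have [xs [bs [xs0 bs0 xsS bsP rxs]]] := row_sequence ab vb rx.
(* The distance of the [j]-th row from the first, times [|a|]; in this scale a band of triangles has
   height [s3 * D]. *)
pose H j := cross a (xs j - x).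
have HS j : H j.+1 = H j + cross a (bs j) by rewrite /H xsS !bilinE; ring.
have D0 := D_gt0.
have bsH j : s3 * D <= cross a (bs j).
  have X : 0 < cross a (bs j) by case: (bsP j) => [[]|[]].
  have h : 3 / 4 * D ^+ 2 <= cross a (bs j) ^+ 2.
    case: (bsP j) => t; first exact/ltW/(rhomb_height D_gt0 t).
    by rewrite (trigon_height t).
  rewrite -(@ler_pXn2r _ 2) // ?nnegrE; last 2 first.
  - by rewrite mulr_ge0 // ltW.
  - exact: ltW.
  by rewrite exprMn g3.
have bH : s3 * D < cross a b.
  rewrite -(@ltr_pXn2r _ 2) // ?nnegrE; last 2 first.
  - by rewrite mulr_ge0 // ltW.
  - exact: ltW.
  by rewrite exprMn g3; apply: (rhomb_height D_gt0 ab).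
have H0 : H 0%N = 0 by rewrite /H xs0 subrr crossr0.
(* Strict from the first band on, because that band consists of rhombi. *)
have Hlow j : j.+1%:R * (s3 * D) < H j.+1.
  elim: j => [|j IH]; first by rewrite HS H0 bs0 mul1r add0r.
  rewrite HS -natr1 mulrDl mul1r; apply: ltr_leD => //; exact: bsH.
have band j y : V y -> H j <= cross a (y - x) < H j.+1 ->
    exists m : int, y = xs j + (m%:~R)%:C * a.
  move=> vy /andP[h1 h2].
  apply: (row_band D_gt0 V_sep (rxs j) _ (bsP j)) => //; first by rewrite -xsS.
  move: h1 h2; rewrite HS /H !bilinE => h1 h2; apply/andP; split; lra.
have s3D : 0 < s3 * D by rewrite mulr_gt0.
have archi (t : R) : 0 <= t -> exists N, t < H N.
  move=> t0; have := archi_boundP (divr_ge0 t0 (ltW s3D)).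
  rewrite ltr_pdivrMr // => h.
  exists (Num.bound (t / (s3 * D))).+1; apply: lt_trans (Hlow _).
  by apply: (lt_trans h); rewrite ltr_pM2r // ltr_nat.
have z0 : 0 < dot z z.
  rewrite lt_def dot_ge0 andbT dot_eq0; apply: contra Ka0 => /eqP z0.
  by move: hK => [m1 [m2 ->]]; rewrite z0 !mulr0 addr0.
have kal : k%:R * cross a l = s3 * dot z z by rewrite -ql qa !bilinE.
have al0 : 0 < cross a l.
  by rewrite -(pmulr_rgt0 _ kR) kal mulr_gt0.
(* The vertex [x + l] lies in some band, hence on its lower row: translation by [l] moves up by
   exactly [s] rows. *)
have [s sl] : exists s, cross a l = H s.
  have [N hN] := archi _ (ltW al0).
  have [j _ /andP[h1 h2]] : exists2 j, (j < N)%N & H j <= cross a l < H j.+1.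
    by apply: between => //; rewrite H0 ltW.
  exists j.
  have e : x + l - x = l by ring.
  have [m hm] := band j (x + l) (vertexD vx hl) ltac:(by rewrite e h1).
  move: (congr1 (fun y => cross a (y - x)) hm) => /=; rewrite e => ->.
  by rewrite /H !bilinE; ring.
case: s sl => [|s] sl; first by move: al0; rewrite sl H0 ltxx.
(* Each center is reduced to a fundamental cell: modulo [l] into one of the first bands, then along
   its row modulo [q = k a]. *)
have main i : exists qp : 'I_s.+1 * 'I_k,
    exists2 l', hex z l' & c i = xs qp.1 + (qp.2%:R)%:C * a + l'.
  set t := cross a (c i - x) / cross a l.
  have := floor_itv t; set f := Num.floor t; rewrite intrD => /andP[f1 f2].
  have f3 : f%:~R * cross a l <= cross a (c i - x) < (f%:~R + 1) * cross a l.
    by rewrite -ler_pdivlMr // f1 -ltr_pdivrMr.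
  pose y := c i + ((- f)%:~R)%:C * l.
  have vci : V (c i) by exists i; exists 0; [exact: hex0|rewrite addr0].
  have vy : V y by apply: vertexD => //; apply: hexMz.
  have yE : cross a (y - x) = cross a (c i - x) - f%:~R * cross a l.
    by rewrite /y !bilinE rmorphN /=; ring.
  have [j js hj] : exists2 j, (j < s.+1)%N & H j <= cross a (y - x) < H j.+1.
    apply: between; first by rewrite H0 yE; lra.
    by rewrite -sl yE; lra.
  have [m mE] := band j y vy hj.
  have kz : (k : int) != 0 by rewrite gt_eqF.
  have mk0 := modz_ge0 m kz.
  have mkk : (`|(m %% k)%Z|%N < k)%N.
    by rewrite -ltz_nat gez0_abs // ltz_pmod.
  exists (Ordinal js, Ordinal mkk); exists (((m %/ k)%Z%:~R)%:C * q + ((f%:~R)%:C * l)).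
    by apply: hexD; apply: hexMz.
  have -> : c i = y + ((f%:~R)%:C * l) by rewrite /y rmorphN rmorphN /=; ring.
  have e : (`|(m %% k)%Z|%:R : R) = (m %% k)%Z%:~R by rewrite -[in RHS](gez0_abs mk0).
  rewrite mE /= {1}(divz_eq m k) e qa rmorphD rmorphM /= rmorphD rmorphM /=.
  by ring.
have {main} /choice[h hP] := main.
have h_inj : injective h.
  move=> i j hij; have [l1 hl1 e1] := hP i; have [l2 hl2 e2] := hP j.
  apply: (@c_inj i j (l1 - l2)); first exact: hexB.
  by rewrite e1 e2 hij; ring.
have nks : (n <= s.+1 * k)%N.
  by have := leq_card h h_inj; rewrite card_prod !card_ord.
have sk : (s.+1 * k)%:R * D < dot z z.
  have := Hlow s; rewrite -sl => hh.
  rewrite -(ltr_pM2l g2) -kal natrM.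
  have -> : s3 * (s.+1%:R * k%:R * D) = k%:R * (s.+1%:R * (s3 * D)) by ring.
  by rewrite ltr_pM2l.
have [nu nuE] : exists nu : int, k%:R ^+ 2 * D = nu%:~R * dot z z.
  have [m1 [m2 qE']] := hq; exists (m1 ^+ 2 + m1 * m2 + m2 ^+ 2).
  by rewrite -norm_hex -qE' qa !bilinE aD; ring.
have nu0 : 0 < nu.
  have : 0 < k%:R ^+ 2 * D by rewrite mulr_gt0 // exprn_gt0.
  by rewrite nuE pmulr_lgt0 // ltr0z.
case: nu nuE nu0 => // nu nuE nu0.
have {}nuE : k%:R ^+ 2 * D = nu%:R * dot z z by [].
have nuR : 0 < nu%:R :> R by rewrite ltr0n.
have k1 : (nu * (s.+1 * k) < k * k)%N.
  rewrite -(ltr_nat R) -(ltr_pM2r D0) !natrM -[k%:R * k%:R]expr2 nuE.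
  by rewrite -natrM -mulrA ltr_pM2l.
have k2 := gap_step nu0 (ltn0Sn s) k1 nks.
rewrite -(ltr_pM2l nuR) -nuE mulrA ltr_pM2r //.
by move: k2; rewrite -(ltr_nat R) !natrM natrD -expr2.
Qed.

End RowDensity.

(** * Edges and faces of the packing graph *)

Section Packing.
Variables (R : realType) (L : set (plane R)) (r : R) (n : nat).
Variable c : 'I_n -> plane R.
Implicit Types (a b d e f x y v w p q : plane R) (s t : R).

Lemma normr_dot v : `|v| = (Num.sqrt (dot v v))%:C.
Proof. by rewrite normc_def /dot !expr2. Qed.

Lemma ball_dot x y t : 0 < t -> ball x t%:C y <-> dot (x - y) (x - y) < t ^+ 2.
Proof.
move=> t0; have -> : ball x t%:C y <-> `|x - y| < t%:C by [].
by rewrite normr_dot ltcR -{1}(ger0_norm (ltW t0)) -sqrtr_sqr ltr_sqrt ?exprn_gt0.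
Qed.

Lemma triangle_ineq t x y : 0 < t -> dot x x < t ^+ 2 -> dot y y < t ^+ 2 ->
  dot (x - y) (x - y) < (2 * t) ^+ 2.
Proof.
move=> t0 hx hy; have := dot_ge0 (x + y).
rewrite norm_diff norm_sum exprMn => h.
have -> : (2 : R) ^+ 2 = 4 by rewrite expr2; lra.
lra.
Qed.

(** If two centers are closer than [2 r], their midpoint is common to both disks. The two translates
    also compare a disk with its own images. *)
Lemma packingP : packing L r c <-> 0 < r /\
  forall i j l l', L l -> L l' ->
    dot (c i + l - (c j + l')) (c i + l - (c j + l')) < (2 * r) ^+ 2 ->
    i = j /\ l = l'.
Proof.
split=> -[r0 h]; split=> //.
  move=> i j l l' hl hl' hd.
  suff [-> ->] : (i, l) = (j, l') by [].
  apply: h => //=; exists ((1 / 2)%:C * (c i + l) + (1 / 2)%:C * (c j + l')).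
  move: hd; set x := c i + l; set y := c j + l' => hd.
  have E : dot ((1/2)%:C * (x - y)) ((1/2)%:C * (x - y)) < r ^+ 2.
    rewrite dotZl dotZr; move: hd; rewrite exprMn; have -> : (2 : R) ^+ 2 = 4 by rewrite expr2; lra.
    by move=> ?; lra.
  have half : (1/2 : R)%:C + (1/2)%:C = 1 :> R[i].
    by rewrite -rmorphD /=; have -> : (1/2 + 1/2 : R) = 1 by lra.
  split; apply/ball_dot => //.
    have -> : x - ((1 / 2)%:C * x + (1 / 2)%:C * y) = (1/2)%:C * (x - y) => //.
    by rewrite -{1}[x]mul1r -half; ring.
  have -> : y - ((1 / 2)%:C * x + (1 / 2)%:C * y) = - ((1/2)%:C * (x - y)).
    by rewrite -{1}[y]mul1r -half; ring.
  by rewrite dotNl dotNr opprK.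
move=> [i l] [j l'] /= hl hl' [w [/ball_dot w1 /ball_dot w2]].
have [|-> ->//] := h i j l l' hl hl'.
have -> : c i + l - (c j + l') = c i + l - w - (c j + l' - w) by ring.
by apply: triangle_ineq => //; [apply: w1|apply: w2].
Qed.

Hypothesis pack : packing L r c.
Hypothesis L0 : L 0.
Hypothesis LB : forall l l', L l -> L l' -> L (l - l').

Let D : R := (2 * r) ^+ 2.
Let V : set (plane R) := vertex L c.

Lemma radius_gt0 : 0 < r.
Proof. by case: pack. Qed.

Lemma D_gt0 : 0 < D.
Proof. by rewrite /D exprn_gt0 // mulr_gt0 // radius_gt0. Qed.

Lemma vertex_sep x y : V x -> V y -> dot (x - y) (x - y) < D -> x = y.
Proof.
move=> [i [l hl ->]] [j [l' hl' ->]] h.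
by have [_ /(_ i j l l' hl hl' h) [-> ->]] := packingP.1 pack.
Qed.

Lemma center_inj i j l : L l -> c i = c j + l -> i = j.
Proof.
move=> hl e; have [_ /(_ i j 0 l L0 hl) []//] := packingP.1 pack.
by rewrite addr0 e subrr dot0l D_gt0.
Qed.

Lemma edgeP x y : edge L r c x y <-> [/\ V x, V y & dot (x - y) (x - y) = D].
Proof.
have r2 : 0 <= 2 * r by rewrite mulr_ge0 // ltW // radius_gt0.
split=> -[vx vy e]; split=> //.
  move: e; rewrite normr_dot => /complexI e.
  by rewrite /D -e sqr_sqrtr // dot_ge0.
by rewrite normr_dot e /D sqrtr_sqr ger0_norm.
Qed.

(** An edge as base point and vector, so that its left side is defined. *)
Definition side x a : Prop := [/\ V x, V (x + a) & dot a a = D].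

Lemma side_edge x a : side x a <-> edge L r c x (x + a).
Proof.
rewrite edgeP /side; have -> : x - (x + a) = - a by ring.
by rewrite dotNl dotNr opprK.
Qed.

Lemma sideN x a : side x a -> side (x + a) (- a).
Proof. by move=> [? ? ?]; split; rewrite ?addrK // dotNl dotNr opprK. Qed.

Let support := graph_support L r c.

Lemma side_support x a t : side x a -> 0 <= t <= 1 -> support (x + t%:C * a).
Proof.
move=> /side_edge h t01; right; exists x, (x + a); split=> //.
by exists t => //; rewrite rmorphB /=; ring.
Qed.

(* Every other vertex is at distance at least [sqrt (3 / 4 * D)] from the
   midpoint of an edge, which leaves no room for another edge nearby. *)
Lemma midpoint_far x a p : side x a -> V p -> p <> x -> p <> x + a ->
  3 / 4 * D <= dot (p - x - (1/2)%:C * a) (p - x - (1/2)%:C * a).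
Proof.
move=> [vx va aD] vp px pa.
have h1 : D <= dot (p - x) (p - x).
  by rewrite leNgt; apply/negP => /(vertex_sep vp vx).
have h2 : D <= dot (p - x - a) (p - x - a).
  have -> : p - x - a = p - (x + a) by ring.
  by rewrite leNgt; apply/negP => /(vertex_sep vp va).
move: h1 h2; move: (p - x) => u.
rewrite !bilinE (dotC a u) aD => h1 h2; lra.
Qed.

(** Another edge has one end at squared distance at least [D / 4] from the midpoint and the other at
    least [3 / 4 * D]. By [norm_combo] its points have squared distance at least
    [((t - 1/4)^2 + 3/16) * D], up to reversing [t]. The value [3/16] is attained on the other sides
    of an equilateral triangle. *)
Lemma near_midpoint x a p q t : side x a -> V p -> V q ->
  dot (p - q) (p - q) = D -> 0 <= t <= 1 ->
  let w := (1 - t)%:C * p + t%:C * q in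
  dot (w - x - (1/2)%:C * a) (w - x - (1/2)%:C * a) < 3 / 16 * D ->
  (p = x /\ q = x + a) \/ (p = x + a /\ q = x).
Proof.
move=> sa vp vq pqD t01 w.
set m := x + (1/2)%:C * a.
have -> : w - x - (1/2)%:C * a = (1 - t)%:C * (p - x - (1/2)%:C * a) + t%:C * (q - x - (1/2)%:C * a).
  by rewrite /w rmorphB /=; ring.
move: pqD; have -> : p - q = (p - x - (1/2)%:C * a) - (q - x - (1/2)%:C * a) by ring.
have mid y : y = x \/ y = x + a ->
    dot (y - x - (1/2)%:C * a) (y - x - (1/2)%:C * a) = D / 4.
  move=> hy; have [_ _ aD] := sa.
  case: hy => ->; last first.
    have -> : x + a - x - (1/2)%:C * a = a - (1/2)%:C * a by ring.
    by rewrite !bilinE aD; lra.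
  by rewrite subrr sub0r !bilinE aD; lra.
set u := p - _ - _; set v := q - _ - _ => uvD h.
have {}h : (1 - t) * dot u u + t * dot v v - t * (1 - t) * D < 3 / 16 * D.
  by rewrite -{1}uvD -norm_combo.
have D0 := D_gt0.
have neq : p <> q.
  by move=> e; move: uvD; rewrite /u /v e subrr dot0l => e0; move: D0; rewrite -e0 ltxx.
have [px|px] := pselect (p = x).
  have [qa|qa] := pselect (q = x + a); first by left.
  have qx : q <> x by rewrite -px; apply/nesym.
  have h1 := midpoint_far sa vq qx qa.
  have h2 : dot u u = D / 4 by apply: (mid p); left.
  rewrite -/v in h1; exfalso.
  have {}h1 : t * (3/4 * D) <= t * dot v v by rewrite ler_wpM2l //; lra.
  have : 0 <= (t - 1/4) ^+ 2 * D by rewrite mulr_ge0 ?sqr_ge0 // ltW.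
  rewrite h2 in h; nra.
have [pa|pa] := pselect (p = x + a).
  have [qx|qx] := pselect (q = x); first by right.
  have qa : q <> x + a by rewrite -pa; apply/nesym.
  have h1 := midpoint_far sa vq qx qa.
  have h2 : dot u u = D / 4 by apply: (mid p); right.
  rewrite -/v in h1; exfalso.
  have {}h1 : t * (3/4 * D) <= t * dot v v by rewrite ler_wpM2l //; lra.
  have : 0 <= (t - 1/4) ^+ 2 * D by rewrite mulr_ge0 ?sqr_ge0 // ltW.
  rewrite h2 in h; nra.
exfalso; have h1 := midpoint_far sa vp px pa; rewrite -/u in h1.
have {}h1 : (1 - t) * (3/4 * D) <= (1 - t) * dot u u by rewrite ler_wpM2l //; lra.
have h2 : D / 4 <= dot v v.
  have [e|e] := pselect (q = x \/ q = x + a); first by rewrite /v mid.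
  have qx : q <> x by move=> e'; apply: e; left.
  have qa : q <> x + a by move=> e'; apply: e; right.
  have := midpoint_far sa vq qx qa; rewrite -/v; lra.
have {}h2 : t * (D / 4) <= t * dot v v by rewrite ler_wpM2l //; lra.
have : 0 <= (1 - t - 1/4) ^+ 2 * D by rewrite mulr_ge0 ?sqr_ge0 // ltW.
nra.
Qed.

Lemma support_near x a w : side x a -> support w ->
  dot (w - x - (1/2)%:C * a) (w - x - (1/2)%:C * a) < 3 / 16 * D ->
  cross a (w - x) = 0.
Proof.
move=> sa [vw|[p [q [/edgeP[vp vq pqD] [t t01 wE]]]]] h.
  have [->|wx] := pselect (w = x); first by rewrite subrr crossr0.
  have [->|wa] := pselect (w = x + a); first by rewrite !bilinE; ring.
  have := midpoint_far sa vw wx wa; have := D_gt0; lra.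
rewrite wE in h.
case: (near_midpoint sa vp vq pqD t01 h) => -[px qx]; rewrite wE px qx.
  have -> : (1 - t)%:C * x + t%:C * (x + a) - x = t%:C * a by rewrite rmorphB /=; ring.
  by rewrite !bilinE mulr0.
have -> : (1 - t)%:C * (x + a) + t%:C * x - x = (1 - t)%:C * a by rewrite rmorphB /=; ring.
by rewrite !bilinE mulr0.
Qed.

(* The point a quarter edge to the left of the midpoint. *)
Definition mleft x a : plane R := x + ((1 / 2) +i* (1 / 4)) * a.

Lemma mleft_dist x a : dot a a = D ->
  dot (mleft x a - x - (1/2)%:C * a) (mleft x a - x - (1/2)%:C * a) < 3 / 16 * D.
Proof.
move=> aD; have -> : dot (mleft x a - x - (1/2)%:C * a) (mleft x a - x - (1/2)%:C * a) = D / 16.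
  by rewrite -aD /mleft; coords; field.
by have := D_gt0; lra.
Qed.

Lemma mleft_cross x a : cross a (mleft x a - x) = dot a a / 4.
Proof. by rewrite /mleft; coords; field. Qed.

Lemma mleft_support x a : side x a -> ~ support (mleft x a).
Proof.
move=> sa hm; have [_ _ aD] := sa.
have := support_near sa hm (mleft_dist x aD).
by rewrite mleft_cross aD; have := D_gt0; lra.
Qed.

(** Each pair holds the values of an affine function at the two ends of a segment. This finds the
    point where the segment leaves a convex polygon. *)
Lemma first_zero (s : seq (R * R)) : (forall u, u \in s -> 0 < u.1) ->
  (forall u, u \in s -> 0 < u.2) \/
  exists2 t, 0 < t <= 1 & (forall u, u \in s -> 0 <= (1 - t) * u.1 + t * u.2) /\
    exists2 u, u \in s & (1 - t) * u.1 + t * u.2 = 0.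
Proof.
elim: s => [|[al be] s IH] h; first by left.
have al0 : 0 < al := h _ (mem_head _ _).
have {}IH := IH (fun u hu => h u (mem_behead (s := (al, be) :: s) hu)).
have hs u : u \in s -> 0 < u.1 by move=> hu; apply: h; rewrite inE hu orbT.
have zero : be <= 0 -> let t := al / (al - be) in 0 < t <= 1 /\ (1 - t) * al + t * be = 0.
  move=> be0 t; have ab : 0 < al - be by lra.
  split; last by rewrite /t; field; rewrite gt_eqF.
  by rewrite /t divr_gt0 // ler_pdivrMr // mul1r; lra.
case: IH => [pos|[t t01 [nn [u us ut]]]].
  have [b0|b0] := ltP 0 be.
    by left=> u; rewrite inE => /orP[/eqP ->|/pos].
  right; have [t01 tz] := zero b0; set t := al / _ in t01 tz.
  exists t => //; split; last by exists (al, be); rewrite ?mem_head.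
  move=> u; rewrite inE => /orP[/eqP -> /=|hu]; first by rewrite tz.
  by rewrite addr_ge0 // mulr_ge0 ?(ltW (hs _ hu)) ?(ltW (pos _ hu)) //; lra.
right; have [ht|ht] := leP 0 ((1 - t) * al + t * be).
  exists t => //; split; last by exists u => //; rewrite inE us orbT.
  by move=> u'; rewrite inE => /orP[/eqP ->|/nn].
have b0 : be <= 0 by nra.
have [t01' tz] := zero b0; set t' := al / _ in t01' tz.
exists t' => //; split; last by exists (al, be); rewrite ?mem_head.
have tt : t' <= t by nra.
move=> u'; rewrite inE => /orP[/eqP -> /=|hu]; first by rewrite tz.
have h1 := nn _ hu; have h2 := hs _ hu.
have h3 : 0 <= t * ((1 - t') * u'.1 + t' * u'.2).
  have -> : t * ((1 - t') * u'.1 + t' * u'.2) = (t - t') * u'.1 + t' * ((1 - t) * u'.1 + t * u'.2) by ring.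
  by rewrite addr_ge0 // mulr_ge0 //; lra.
by move: h3; rewrite pmulr_rge0 //; lra.
Qed.

End Packing.

(** * Polygonal faces, recognised near the midpoint of an edge *)

Section Faces.
Variables (R : realType) (L : set (plane R)) (r : R) (n : nat).
Variable c : 'I_n -> plane R.
Implicit Types (a b d e f x y v w p q : plane R) (s t : R) (F : set (plane R)).

Hypothesis pack : packing L r c.

Let D : R := (2 * r) ^+ 2.
Let V : set (plane R) := vertex L c.
Let support := graph_support L r c.
Let D0 : 0 < D := D_gt0 pack.
Local Notation side := (side L r c).

(** The segment from [w] to the midpoint of the edge has to leave [F], because the midpoint is in
    the graph. The exit point is on a side of [F] and still close to the midpoint, so by
    [near_midpoint] this side is the edge, up to direction. *)
Lemma polygon_side F (s : seq (plane R * plane R)) x a w :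
  (forall u, F u <-> forall pe, pe \in s -> 0 < cross pe.2 (u - pe.1)) ->
  (forall pe, pe \in s -> side pe.1 pe.2) ->
  (forall pe u, pe \in s -> (forall pe', pe' \in s -> 0 <= cross pe'.2 (u - pe'.1)) ->
     cross pe.2 (u - pe.1) = 0 -> exists2 t, 0 <= t <= 1 & u = pe.1 + t%:C * pe.2) ->
  (forall u, F u -> ~ support u) -> side x a -> F w ->
  dot (w - x - (1/2)%:C * a) (w - x - (1/2)%:C * a) < 3 / 16 * D ->
  (x, a) \in s \/ (x + a, - a) \in s.
Proof.
move=> FE Fs Fb Fsup sa Fw near.
pose m := x + (1/2)%:C * a.
pose f u (pe : plane R * plane R) : R := cross pe.2 (u - pe.1).
pose wt t := (1 - t)%:C * w + t%:C * m.
have fE t pe : (1 - t) * f w pe + t * f m pe = f (wt t) pe.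
  rewrite /f /wt; have -> : (1 - t)%:C * w + t%:C * m - pe.1 = (1 - t)%:C * (w - pe.1) + t%:C * (m - pe.1).
    by rewrite rmorphB /=; ring.
  by rewrite [in RHS]crossDr !crossZr.
have [|pos|[t t01 [nn [u us uz]]]] := @first_zero R [seq (f w pe, f m pe) | pe <- s].
- by move=> u /mapP[pe hpe ->] /=; apply: (FE w).1.
- exfalso; apply: (Fsup m); last by apply: side_support => //; lra.
  apply/FE => pe hpe; apply: (pos (f w pe, f m pe)).
  by apply/mapP; exists pe.
move/mapP: us uz => [[p e] hpe ->] /=; rewrite fE => uz.
have [t' t'01 wE] : exists2 t', 0 <= t' <= 1 & wt t = p + t'%:C * e.
  apply: (Fb (p, e)) => // pe' hpe'.
  have := nn (f w pe', f m pe') => /=; rewrite fE; apply.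
  by apply/mapP; exists pe'.
have [vp vq eD] := Fs _ hpe; rewrite /= in vp vq eD.
have pqD : dot (p - (p + e)) (p - (p + e)) = D.
  have -> : p - (p + e) = - e by ring.
  by rewrite dotNl dotNr opprK.
have := near_midpoint pack sa vp vq pqD t'01; rewrite /=.
have -> : (1 - t')%:C * p + t'%:C * (p + e) - x - (1/2)%:C * a = (1 - t)%:C * (w - x - (1/2)%:C * a).
  transitivity (wt t - x - (1/2)%:C * a); first by rewrite wE rmorphB /=; ring.
  by rewrite /wt /m rmorphB /=; ring.
case.
- rewrite !bilinE -/D; move: near; rewrite !bilinE.
  set N := (X in X < _) => hN.
  have N0 : 0 <= N.
    by have := dot_ge0 (w - x - (1/2)%:C * a); rewrite !bilinE.
  set N' := (X in X < _); have -> : N' = (1 - t) ^+ 2 * N by rewrite /N' /N; ring.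
  apply: le_lt_trans hN; rewrite ler_piMl //.
  by rewrite expr_le1 //; lra.
- by move=> [px] /eqP; rewrite px (inj_eq (addrI x)) => /eqP ea; left; rewrite -ea -px.
- move=> [px qx]; right; rewrite -px; suff -> : - a = e by [].
  by apply: (@addrI _ p); rewrite qx px addrK.
Qed.

(** A rhombic face with explicit corners, to the left of its base edge [a]; missing the graph stands
    for being a connected component. *)
Definition rface x a b : Prop :=
  [/\ rhomb D a b, [/\ V x, V (x + a), V (x + b) & V (x + a + b)] &
      forall w, open_parallelogram x a b w -> ~ support w].

Definition tface x a b : Prop :=
  [/\ trigon D a b, [/\ V x, V (x + a) & V (x + b)] &
      forall w, open_triangle x (x + a) (x + b) w -> ~ support w].

Lemma parallelogramP x a b w : 0 < cross a b ->
  open_parallelogram x a b w <->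
  0 < cross (w - x) b < cross a b /\ 0 < cross a (w - x) < cross a b.
Proof.
move=> X0; have Xn : cross a b != 0 by rewrite gt_eqF.
split.
  move=> [s [t [/andP[s0 s1] /andP[t0 t1] ->]]].
  have -> : x + s%:C * a + t%:C * b - x = s%:C * a + t%:C * b by ring.
  rewrite !bilinE !mulr0 addr0 add0r.
  by split; rewrite pmulr_lgt0 // gtr_pMl // ?s0 ?t0 ?s1 ?t1.
move=> [/andP[s0 s1] /andP[t0 t1]].
exists (cross (w - x) b / cross a b), (cross a (w - x) / cross a b).
split; try by rewrite divr_gt0 // ltr_pdivrMr // mul1r.
by rewrite -addrA -coordE // addrC subrK.
Qed.

Lemma triangleP x a b w : 0 < cross a b ->
  open_triangle x (x + a) (x + b) w <->
  [/\ 0 < cross (w - x) b, 0 < cross a (w - x) &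
      cross (w - x) b + cross a (w - x) < cross a b].
Proof.
move=> X0; have Xn : cross a b != 0 by rewrite gt_eqF.
split.
  move=> [s [t [q [s0 t0 q0 h ->]]]].
  have -> : s%:C * x + t%:C * (x + a) + q%:C * (x + b) - x = t%:C * a + q%:C * b.
    have -> : s = 1 - t - q by lra.
    by rewrite !rmorphB /=; ring.
  rewrite !bilinE !mulr0 addr0 add0r.
  split; rewrite ?pmulr_lgt0 // -mulrDl gtr_pMl //; lra.
move=> [s0 t0 h].
exists (1 - cross (w - x) b / cross a b - cross a (w - x) / cross a b),
  (cross (w - x) b / cross a b), (cross a (w - x) / cross a b).
split; rewrite ?divr_gt0 //.
- have : (cross (w - x) b + cross a (w - x)) / cross a b < 1 by rewrite ltr_pdivrMr ?mul1r.
  rewrite mulrDl; lra.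
- by lra.
- set s := _ / _; set t := cross a _ / _.
  transitivity (x + (s%:C * a + t%:C * b)); last by rewrite !rmorphB /=; ring.
  by rewrite -coordE // addrC subrK.
Qed.

Lemma parallelogram_coord e f x u : 0 < cross e f -> exists S T : R,
  [/\ u = x + S%:C * e + T%:C * f, cross (u - x) f = S * cross e f &
      cross e (u - x) = T * cross e f].
Proof.
move=> X0; have Xn : cross e f != 0 by rewrite gt_eqF.
exists (cross (u - x) f / cross e f), (cross e (u - x) / cross e f); split.
- by rewrite -addrA -coordE // addrC subrK.
- by rewrite divfK.
- by rewrite divfK.
Qed.

Lemma rhombN a b : rhomb D a b -> rhomb D b (- a).
Proof.
move=> [aD bD X p]; split => //; first by rewrite dotNl dotNr opprK.
  by rewrite crossNr -crossC.
by rewrite dotNr normrN dotC.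
Qed.

Lemma trigonN a b : trigon D a b -> trigon D (b - a) (- a).
Proof.
move=> t; have [tD X p] := trigon_turn t; have [aD bD X' _] := t.
split => //; first by rewrite dotNl dotNr opprK.
  by rewrite crossNr -crossC X.
by rewrite dotNr dotC p opprK.
Qed.

Lemma parallelogram_rot x a b :
  open_parallelogram (x + a) b (- a) = open_parallelogram x a b.
Proof.
apply/seteqP; split => w [s [t [s01 t01 ->]]].
  exists (1 - t), s; split => //; first lra.
  by rewrite rmorphB /=; ring.
exists t, (1 - s); split => //; first lra.
by rewrite rmorphB /=; ring.
Qed.

Lemma triangle_rot x a b : open_triangle (x + a) (x + b) x = open_triangle x (x + a) (x + b).
Proof.
apply/seteqP; split => w [s [t [q [s0 t0 q0 h ->]]]].
  by exists q, s, t; split => //; [lra|ring].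
by exists t, q, s; split => //; [lra|ring].
Qed.

Lemma rface_rot x a b : rface x a b -> rface (x + a) b (- a).
Proof.
move=> [h [vx va vb vab] hs]; split; rewrite ?parallelogram_rot //; first exact: rhombN.
have -> : x + a - a = x by ring.
by have -> : x + a + b - a = x + b by ring.
Qed.

Lemma rface_side x a b : rface x a b -> side x a.
Proof. by move=> [[aD _ _ _] [? ? _ _] _]. Qed.

Definition rface_edges x a b : seq (plane R * plane R) :=
  [:: (x, a); (x + a, b); (x + a + b, - a); (x + a + b - a, - b)].

Lemma rface_sides x' e f x a w : rface x' e f -> side x a ->
  open_parallelogram x' e f w ->
  dot (w - x - (1/2)%:C * a) (w - x - (1/2)%:C * a) < 3 / 16 * D ->
  (x, a) \in rface_edges x' e f \/ (x + a, - a) \in rface_edges x' e f.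
Proof.
move=> rf sa Fw near.
have rf1 := rface_rot rf; have rf2 := rface_rot rf1; have rf3 := rface_rot rf2.
have [[eD fD X0 _] _ sup] := rf.
have Xn : cross e f != 0 by rewrite gt_eqF.
pose s := [:: (x', e); (x' + e, f); (x' + e + f, - e); (x' + e + f - e, - f)].
have P (Q : plane R * plane R -> Prop) : (forall pe, pe \in s -> Q pe) <->
   [/\ Q (x', e), Q (x' + e, f), Q (x' + e + f, - e) & Q (x' + e + f - e, - f)].
  split=> [h|[h1 h2 h3 h4] pe]; first by split; apply: h; rewrite !inE eqxx ?orbT.
  by rewrite !inE => /or4P[] /eqP ->.
have C u : [/\ cross e (u - x') = cross e (u - x'),
    cross f (u - (x' + e)) = cross e f - cross (u - x') f,
    cross (- e) (u - (x' + e + f)) = cross e f - cross e (u - x') &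
    cross (- f) (u - (x' + e + f - e)) = cross (u - x') f].
  split => //; rewrite !bilinE ?(crossC f); ring.
apply: (@polygon_side (open_parallelogram x' e f) s x a w) => //.
- move=> u; rewrite P /= parallelogramP //; have [_ -> -> ->] := C u.
  split=> [[/andP[h1 h2] /andP[h3 h4]]|[h1 h2 h3 h4]]; first by split; lra.
  by split; apply/andP; split; lra.
- by rewrite P /=; split; apply: rface_side; eassumption.
- move=> pe u hpe; rewrite P /=; have [C1 C2 C3 C4] := C u; rewrite C2 C3 C4.
  have [S [T [uE SE TE]]] := parallelogram_coord x' u X0.
  rewrite SE TE => -[h1 h2 h3 h4]; move: pe hpe; rewrite P /= C2 C3 C4 SE TE.
  rewrite pmulr_lge0 // in h1; rewrite pmulr_lge0 // in h4.
  have {}h3 : T <= 1 by rewrite -(ler_pM2r X0) mul1r; lra.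
  have {}h2 : S <= 1 by rewrite -(ler_pM2r X0) mul1r; lra.
  have one (t : R) : cross e f - t * cross e f = 0 -> t = 1.
    by move=> h; apply: (mulIf Xn); rewrite mul1r; lra.
  have zero (t : R) : t * cross e f = 0 -> t = 0.
    by move=> h; apply: (mulIf Xn); rewrite mul0r.
  split=> [/zero z|/one z|/one z|/zero z].
  + by exists S; [lra|rewrite uE z; ring].
  + by exists T; [lra|rewrite uE z; ring].
  + by exists (1 - S); [lra|rewrite uE z rmorphB /=; ring].
  + by exists (1 - T); [lra|rewrite uE z rmorphB /=; ring].
Qed.

(** The edge is a side by [rface_sides], and rotation makes it the base. In the second alternative
    the rhombus lies to the right of [a]. *)
Lemma rface_near x' e f x a w : rface x' e f -> side x a ->
  open_parallelogram x' e f w ->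
  dot (w - x - (1/2)%:C * a) (w - x - (1/2)%:C * a) < 3 / 16 * D ->
  exists b, (rface x a b /\ open_parallelogram x a b = open_parallelogram x' e f) \/
    (rface (x + a) (- a) b /\ open_parallelogram (x + a) (- a) b = open_parallelogram x' e f).
Proof.
move=> rf sa Fw near.
have rf1 := rface_rot rf; have rf2 := rface_rot rf1; have rf3 := rface_rot rf2.
have E (b : plane R * plane R) : b \in rface_edges x' e f -> exists d, rface b.1 b.2 d /\
    open_parallelogram b.1 b.2 d = open_parallelogram x' e f.
  rewrite !inE => /or4P[] /eqP -> /=.
  - by exists f.
  - by exists (- e); rewrite parallelogram_rot.
  - by exists (- f); rewrite !parallelogram_rot.
  - by exists (- - e); rewrite !parallelogram_rot.
by case: (rface_sides rf sa Fw near) => /E[b h]; exists b; [left|right].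
Qed.

Lemma tface_rot x a b : tface x a b -> tface (x + a) (b - a) (- a).
Proof.
move=> [h [vx va vb] hs].
have e1 : x + a + (b - a) = x + b by ring.
have e2 : x + a - a = x by ring.
split; rewrite ?e1 ?e2 ?triangle_rot //; exact: trigonN.
Qed.

Lemma tface_side x a b : tface x a b -> side x a.
Proof. by move=> [[aD _ _ _] [? ? _] _]. Qed.

Lemma tface_near x' e f x a w : tface x' e f -> side x a ->
  open_triangle x' (x' + e) (x' + f) w ->
  dot (w - x - (1/2)%:C * a) (w - x - (1/2)%:C * a) < 3 / 16 * D ->
  exists b, (tface x a b /\ open_triangle x (x + a) (x + b) = open_triangle x' (x' + e) (x' + f)) \/
    (tface (x + a) (- a) b /\
      open_triangle (x + a) (x + a - a) (x + a + b) = open_triangle x' (x' + e) (x' + f)).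
Proof.
move=> rf sa Fw near.
have rf1 := tface_rot rf; have rf2 := tface_rot rf1.
have [[eD fD X0 _] _ sup] := rf.
have Xn : cross e f != 0 by rewrite gt_eqF.
pose s := [:: (x', e); (x' + e, f - e); (x' + e + (f - e), - e - (f - e))].
have P (Q : plane R * plane R -> Prop) : (forall pe, pe \in s -> Q pe) <->
   [/\ Q (x', e), Q (x' + e, f - e) & Q (x' + e + (f - e), - e - (f - e))].
  split=> [h|[h1 h2 h3] pe]; first by split; apply: h; rewrite !inE eqxx ?orbT.
  by rewrite !inE => /or3P[] /eqP ->.
have C u : [/\ cross e (u - x') = cross e (u - x'),
    cross (f - e) (u - (x' + e)) = cross e f - cross (u - x') f - cross e (u - x') &
    cross (- e - (f - e)) (u - (x' + e + (f - e))) = cross (u - x') f].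
  split => //; rewrite !bilinE ?(crossC f); ring.
have T1 : open_triangle (x' + e) (x' + e + (f - e)) (x' + e + - e) = open_triangle x' (x' + e) (x' + f).
  by rewrite -[RHS]triangle_rot; congr (open_triangle _ _ _); ring.
have T2 : open_triangle (x' + e + (f - e)) (x' + e + (f - e) + (- e - (f - e)))
    (x' + e + (f - e) + - (f - e)) = open_triangle x' (x' + e) (x' + f).
  by rewrite -T1 -[RHS]triangle_rot; congr (open_triangle _ _ _); ring.
have := @polygon_side (open_triangle x' (x' + e) (x' + f)) s x a w.
case=> //.
- move=> u; rewrite P /= triangleP //; have [_ -> ->] := C u.
  by split=> [[h1 h2 h3]|[h1 h2 h3]]; split; lra.
- by rewrite P /=; split; apply: tface_side; eassumption.
- move=> pe u hpe; rewrite P /=; have [C1 C2 C3] := C u; rewrite C2 C3.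
  have [S [T [uE SE TE]]] := parallelogram_coord x' u X0.
  rewrite SE TE => -[h1 h2 h3]; move: pe hpe; rewrite P /= C2 C3 SE TE.
  rewrite pmulr_lge0 // in h1; rewrite pmulr_lge0 // in h3.
  have {}h2 : S + T <= 1 by rewrite -(ler_pM2r X0) mul1r mulrDl; lra.
  have one : cross e f - S * cross e f - T * cross e f = 0 -> S = 1 - T.
    by move=> h; apply: (mulIf Xn); rewrite mulrBl mul1r; lra.
  have zero (t : R) : t * cross e f = 0 -> t = 0.
    by move=> h; apply: (mulIf Xn); rewrite mul0r.
  split=> [/zero z|/one z|/zero z].
  + by exists S; [lra|rewrite uE z; ring].
  + by exists T; [lra|rewrite uE z rmorphB /=; ring].
  + by exists (1 - T); [lra|rewrite uE z rmorphB /=; ring].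
- rewrite !inE => /or3P[] /eqP[-> ->].
  + by exists f; left.
  + by exists (- e); left.
  + by exists (- (f - e)); left.
- rewrite !inE => /or3P[] /eqP[-> ->].
  + by exists f; right.
  + exists (- e); right; split => //.
  + by exists (- (f - e)); right; split => //.
Qed.

End Faces.

(** * The face to the left of a directed edge *)

Section LeftFaces.
Variables (R : realType) (L : set (plane R)) (r : R) (n : nat).
Variable c : 'I_n -> plane R.
Implicit Types (a b d e f x y v w p q : plane R) (s t : R) (F : set (plane R)).

Hypothesis pack : packing L r c.

Let D : R := (2 * r) ^+ 2.
Let V : set (plane R) := vertex L c.
Let support := graph_support L r c.
Let D0 : 0 < D := D_gt0 pack.
Local Notation side := (side L r c).
Local Notation rface := (rface L r c).
Local Notation tface := (tface L r c).

Lemma face_support F w : face L r c F -> F w -> ~ support w.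
Proof. by move=> [u _ ->] /(@connected_component_sub _ _ _ _). Qed.

(** Only the angle needs an argument: otherwise a diagonal has squared length at most [D], so it is
    an edge, and its midpoint, the center of the parallelogram, is in the graph. *)
Lemma rface_intro x a b : side x a -> side x b -> V (x + a + b) ->
  0 < cross a b -> (forall w, open_parallelogram x a b w -> ~ support w) -> rface x a b.
Proof.
move=> [vx va aD] [_ vb bD] vab X0 sup; split => //; split => //.
have half : 0 < (1/2 : R) < 1 by lra.
have half' : 0 <= (1/2 : R) <= 1 by lra.
have dlt : dot a b < D / 2.
  rewrite ltNge; apply/negP => h.
  have ba : x + b + (a - b) = x + a by ring.
  have : side (x + b) (a - b).
    split => //; rewrite ?ba //; apply/eqP; rewrite eq_le; apply/andP; split.
      by rewrite norm_diff aD bD -/D; lra.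
    rewrite leNgt; apply/negP => h'.
    have E : x + a - (x + b) = a - b by ring.
    have := vertex_sep pack va vb; rewrite E => /(_ h') /addrI ab.
    by move: X0; rewrite ab crossxx ltxx.
  move/(side_support pack) => /(_ _ half'); apply: sup; exists (1/2), (1/2); split => //.
  have {1}-> : x + b + (1 / 2)%:C * (a - b) = x + (1/2)%:C * a + (1 - (1/2))%:C * b.
    by rewrite rmorphB /=; ring.
  by congr (_ + _%:C * _); lra.
have dgt : - (D / 2) < dot a b.
  rewrite ltNge; apply/negP => h.
  have : side x (a + b).
    split => //; rewrite ?addrA //; apply/eqP; rewrite eq_le; apply/andP; split.
      by rewrite norm_sum aD bD -/D; lra.
    rewrite leNgt; apply/negP => h'.
    have E : x + a + b - x = a + b by ring.
    have := vertex_sep pack vab vx; rewrite E => /(_ h') ab.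
    have {}ab : a = - b.
      by apply/eqP; rewrite -subr_eq0 opprK; apply/eqP; rewrite -E ab subrr.
    by move: X0; rewrite ab crossNl crossxx oppr0 ltxx.
  move/(side_support pack) => /(_ _ half'); apply: sup; exists (1/2), (1/2); split => //.
  by ring.
by rewrite ltr_norml dgt.
Qed.

(** A flat parallelogram would contain one of the vertices [x] and [x + a]; negative orientation is
    repaired by exchanging the sides. *)
Lemma rhombic_rface F : rhombic_face L r c F ->
  exists x a b, rface x a b /\ F = open_parallelogram x a b.
Proof.
move=> [fF [x [a [b [/(side_edge pack) ea /(side_edge pack) eb /(side_edge pack) eab _ FE]]]]].
have sup w : open_parallelogram x a b w -> ~ support w by rewrite -FE; apply: face_support.
have [vx va aD] := ea; have [_ vb bD] := eb; have [_ vab _] := eab.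
have half : 0 < (1/2 : R) < 1 by lra.
have halfE y : (1/2 : R)%:C * y + (1/2)%:C * y = y.
  have e : (1/2 + 1/2 : R) = 1 by lra.
  by rewrite -mulrDl -rmorphD /= e mul1r.
have Xn : cross a b != 0.
  apply: (cross_neq0 aD bD) => ab.
    apply: (sup (x + a)); last by left.
    by exists (1/2), (1/2); split => //; rewrite -ab -addrA halfE.
  apply: (sup x); last by left.
  by exists (1/2), (1/2); split => //; rewrite ab; ring.
have [X0|X0|X0] := ltgtP 0 (cross a b).
- by exists x, a, b; split => //; apply: rface_intro => //; split.
- exists x, b, a; have swap : open_parallelogram x b a = open_parallelogram x a b.
    by apply/seteqP; split => w [s [t [s1 t1 ->]]]; exists t, s; split => //; ring.
  split; last by rewrite swap.
  apply: rface_intro; last by rewrite swap.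
  + exact: eb.
  + exact: ea.
  + by have -> : x + b + a = x + a + b by ring.
  + by rewrite crossC oppr_gt0.
- by rewrite -X0 eqxx in Xn.
Qed.

Lemma tface_intro x a b : side x a -> side x b -> dot (b - a) (b - a) = D ->
  0 < cross a b -> (forall w, open_triangle x (x + a) (x + b) w -> ~ support w) ->
  tface x a b.
Proof.
move=> [vx va aD] [_ vb bD] abD X0 sup; split => //; split => //.
by move: abD; rewrite norm_diff (dotC b a) aD bD -/D; lra.
Qed.

Lemma triangular_tface F : triangular_face L r c F ->
  exists x a b, tface x a b /\ F = open_triangle x (x + a) (x + b).
Proof.
move=> [fF [x [y [z [/(edgeP pack)[vx vy xyD] /(edgeP pack)[_ vz yzD]
  /(edgeP pack)[_ _ zxD] FE]]]]].
pose a := y - x; pose b := z - x.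
have yE : y = x + a by rewrite /a; ring.
have zE : z = x + b by rewrite /b; ring.
have aD : dot a a = D by rewrite /a -[RHS]xyD -opprB !bilinE; ring.
have bD : dot b b = D by rewrite /b -[RHS]zxD.
have abD : dot (a - b) (a - b) = D.
  by rewrite -[RHS]yzD; have -> : y - z = a - b by rewrite /a /b; ring.
have baD : dot (b - a) (b - a) = D by rewrite -abD !bilinE; ring.
have sup w : open_triangle x (x + a) (x + b) w -> ~ support w.
  by rewrite -yE -zE -FE; apply: face_support.
have sa : side x a by split => //; rewrite -yE.
have sb : side x b by split => //; rewrite -zE.
clearbody a b.
have Xn : cross a b != 0.
  have h := D0; apply: (cross_neq0 aD bD) => ab; move: abD.
    by rewrite ab subrr dot0l => e; rewrite e ltxx in h.
  rewrite ab norm_diff !bilinE bD => e; lra.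
have [X0|X0|X0] := ltgtP 0 (cross a b).
- exists x, a, b; rewrite -yE -zE; split => //; apply: tface_intro => //.
- exists x, b, a; rewrite -yE -zE.
  have swap : open_triangle x z y = open_triangle x y z.
    apply/seteqP; split => w [s [t [q [s1 t1 q1 h ->]]]]; exists s, q, t; split => //;
      [lra|ring|lra|ring].
  split; last by rewrite swap.
  by apply: tface_intro => //; rewrite -?yE -?zE ?swap ?yE ?zE // crossC oppr_gt0.
- by rewrite -X0 eqxx in Xn.
Qed.

Definition lface x a : set (plane R) := connected_component (~` support) (mleft x a).

Lemma lface_face x a : side x a -> face L r c (lface x a).
Proof. by move=> sa; exists (mleft x a) => //; apply: mleft_support. Qed.

Lemma lface_mleft x a : side x a -> lface x a (mleft x a).
Proof. by move=> sa; apply: connected_component_refl; apply: mleft_support. Qed.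

Lemma mleft_not_right x a : side x a -> 0 < cross (- a) (mleft x a - (x + a)) -> False.
Proof.
move=> [_ _ aD]; have -> : mleft x a - (x + a) = mleft x a - x - a by ring.
rewrite crossNl crossDr mleft_cross crossNr crossxx aD.
by have h : 0 < (2 * r) ^+ 2 := D0; lra.
Qed.

(** Of the two positions left by [rface_near], the one to the right of [a] does not contain
    [mleft]. *)
Lemma lface_rhombic x a : side x a -> rhombic_face L r c (lface x a) ->
  exists b, rface x a b /\ lface x a = open_parallelogram x a b.
Proof.
move=> sa /rhombic_rface[x' [e [f [Fr FE]]]]; have mF := lface_mleft sa.
have [_ _ aD] := sa; have near := mleft_dist pack x aD.
rewrite FE in mF *.
have [b [[rb bE]|[rb bE]]] := rface_near pack Fr sa mF near; first by exists b; rewrite bE.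
move: mF; rewrite -bE => /parallelogramP; have [[_ _ X0 _] _ _] := rb.
by move=> /(_ X0)[_ /andP[h _]]; case: (mleft_not_right sa h).
Qed.

Lemma lface_triangular x a : side x a -> triangular_face L r c (lface x a) ->
  exists b, tface x a b /\ lface x a = open_triangle x (x + a) (x + b).
Proof.
move=> sa /triangular_tface[x' [e [f [Fr FE]]]]; have mF := lface_mleft sa.
have [_ _ aD] := sa; have near := mleft_dist pack x aD.
rewrite FE in mF *.
have [b [[rb bE]|[rb bE]]] := tface_near pack Fr sa mF near; first by exists b; rewrite bE.
move: mF; rewrite -bE => /triangleP; have [[_ _ X0 _] _ _] := rb.
by move=> /(_ X0)[_ h _]; case: (mleft_not_right sa h).
Qed.

Hypothesis faces : forall F, face L r c F -> rhombic_face L r c F \/ triangular_face L r c F.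

Lemma lface_cases x a : side x a ->
  (exists b, rface x a b /\ lface x a = open_parallelogram x a b) \/
  (exists b, tface x a b /\ lface x a = open_triangle x (x + a) (x + b)).
Proof.
move=> sa; case: (faces (lface_face sa)) => h.
  by left; apply: lface_rhombic.
by right; apply: lface_triangular.
Qed.

Lemma vertex_left x a : V x -> V (x + a) -> dot a a = D ->
  (exists b, [/\ rhomb D a b, V (x + b) & V (x + a + b)]) \/
  (exists b, trigon D a b /\ V (x + b)).
Proof.
move=> vx va aD; have sa : side x a by split.
by case: (lface_cases sa) => -[b [[h hv _] _]]; [left|right]; exists b; split => //; case: hv.
Qed.

(** The left face has a tip by [lface_cases], and tips are unique, so an empty rhombus based at the
    edge is that face. *)
Lemma rface_lface x a b : rface x a b -> lface x a = open_parallelogram x a b.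
Proof.
move=> rb; have [h [vx va vb _] _] := rb.
have sep := V_sepD (vertex_sep pack).
case: (lface_cases (rface_side rb)) => -[b' [[h' hv _] ->]].
  by have [_ _ vb' _] := hv; rewrite (sep _ _ _ vb vb' (rhomb_close D0 h h')).
have [_ _ vb'] := hv; case: (rhomb_not_trigon D0 h).
by rewrite (sep _ _ _ vb vb' (rhomb_trigon_close D0 h h')).
Qed.

End LeftFaces.

(** * First-order motions *)

Section Jamming.
Variables (R : realType) (r : R) (n : nat) (z : plane R).
Variable c : 'I_n -> plane R.
Implicit Types (a b d e f u v w x y p q : plane R) (s t : R).

Let L : set (plane R) := hex z.
Let D : R := (2 * r) ^+ 2.

Lemma uniform_threshold (I : eqType) (P : I -> R -> Prop) (s : seq I) :
  (forall i t t', P i t -> 0 < t' <= t -> P i t') ->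
  (forall i, i \in s -> exists2 t, 0 < t & P i t) ->
  exists2 t, 0 < t & forall i, i \in s -> P i t.
Proof.
move=> mono; elim: s => [|i s IH] h; first by exists 1.
have [t t0 ht] : exists2 t, 0 < t & forall i, i \in s -> P i t.
  by apply: IH => j js; apply: h; rewrite inE js orbT.
have [t' t'0 ht'] := h i (mem_head _ _).
have m0 : 0 < Num.min t t' by rewrite lt_min t0.
exists (Num.min t t') => // j; rewrite inE => /orP[/eqP ->|js].
  by apply: mono ht' _; rewrite m0 ge_min lexx orbT.
by apply: mono (ht _ js) _; rewrite m0 ge_min lexx.
Qed.

Lemma affine_threshold (A B : R) : 0 < A -> exists2 t, 0 < t & forall s, 0 <= s <= t -> 0 <= A + s * B.
Proof.
move=> A0; have B1 : 0 < `|B| + 1 by rewrite ltr_wpDl.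
exists (A / (`|B| + 1)); first by rewrite divr_gt0.
move=> s /andP[s0 sA]; rewrite ler_pdivlMr // in sA.
have : - `|B| <= B by rewrite lerNl ler_normr lexx orbT.
nra.
Qed.

Lemma ord_int (B : nat) (m : int) : `|m| < B%:Z ->
  exists i : 'I_(B.*2), m = (i : int) - B%:Z.
Proof.
move=> h; have lt : (absz (m + B%:Z)%R < B.*2)%N by lia.
by exists (Ordinal lt) => /=; lia.
Qed.

(** Since [m1^2 + m2^2 <= 2 (m1^2 + m1 m2 + m2^2)], short lattice vectors have small coefficients;
    only finitely many translates matter. *)
Lemma hex_far (v : plane R) (C : R) : z != 0 -> exists B : nat, forall m1 m2 : int,
  dot (v + (m1%:~R * z + m2%:~R * (gDelta R * z)))
      (v + (m1%:~R * z + m2%:~R * (gDelta R * z))) < C ->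
  (`|m1| < B)%R /\ (`|m2| < B)%R.
Proof.
move=> z0; have zz : 0 < dot z z by rewrite lt_def dot_eq0 z0 dot_ge0.
pose X := 4 * (C + dot v v) / dot z z.
exists (Num.bound X).+1 => m1 m2; set l := _ + _ * _ => h.
have hl : dot l l <= 2 * (C + dot v v).
  by have := norm_le_sum v l; lra.
have hm : (m1 ^+ 2 + m2 ^+ 2)%:~R <= X.
  rewrite /X ler_pdivlMr //; move: hl; rewrite norm_hex => hl.
  have : (m1 ^+ 2 + m2 ^+ 2)%:~R * dot z z <= 2 * ((m1 ^+ 2 + m1 * m2 + m2 ^+ 2)%:~R * dot z z).
    rewrite mulrA ler_pM2r // -[2]/(2%:~R) -intrM ler_int.
    have : 0 <= (m1 + m2) ^+ 2 by exact: sqr_ge0.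
    nia.
  lra.
have X0 : 0 <= X.
  by apply: le_trans hm; rewrite ler0z addr_ge0 ?sqr_ge0.
have hb : (m1 ^+ 2 + m2 ^+ 2 < (Num.bound X)%:Z).
  by rewrite -(ltr_int R); apply: le_lt_trans hm _; apply: archi_boundP.
move: hb; move: (Num.bound X) => B hb.
have k (m : int) : `|m| <= m ^+ 2 by nia.
have := k m1; have := k m2; have := sqr_ge0 m1; have := sqr_ge0 m2.
by move=> *; split; lia.
Qed.

Hypothesis z_neq0 : z != 0.
Hypothesis jam : collectively_jammed L r c.

Let pack : packing L r c := jam.1.

(** Tangent translates do not approach, as the quadratic term is nonnegative; the finitely many
    nearby ones keep their slack for a short time; distant ones stay out of reach up to time 1. *)
Lemma pair_threshold (w : 'I_n -> plane R) i j :
  (forall l, L l -> dot (c i + l - c j) (c i + l - c j) = D ->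
     0 <= dot (w i - w j) (c i + l - c j)) ->
  exists2 t, 0 < t & forall s l, 0 <= s <= t -> L l ->
    dot (c i + l - c j + s%:C * (w i - w j)) (c i + l - c j + s%:C * (w i - w j)) < D ->
    i = j /\ l = 0.
Proof.
move=> hw; set v := w i - w j in hw *; clearbody v.
have expand u s : dot (u + s%:C * v) (u + s%:C * v) =
    dot u u + 2 * s * dot v u + s ^+ 2 * dot v v.
  by rewrite !bilinE (dotC u v); ring.
(* By [norm_le_sum], a translate that overlaps at a time [s <= 1] starts at squared distance below
   [C]. *)
pose C := 2 * D + 2 * dot v v.
have [B hB] := hex_far (c i - c j) C z_neq0.
pose lm (m : 'I_(B.*2) * 'I_(B.*2)) : plane R :=
  ((m.1 : int) - B%:Z)%:~R * z + ((m.2 : int) - B%:Z)%:~R * (gDelta R * z).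
pose u m := c i + lm m - c j.
have [t t0 ht] : exists2 t, 0 < t & forall m, m \in enum {: 'I_(B.*2) * 'I_(B.*2)} ->
    D < dot (u m) (u m) -> forall s, 0 <= s <= t -> D <= dot (u m) (u m) + s * (2 * dot v (u m)).
  apply: (uniform_threshold (P := fun m t => D < dot (u m) (u m) ->
     forall s, 0 <= s <= t -> D <= dot (u m) (u m) + s * (2 * dot v (u m)))).
    by move=> m t t' h /andP[t0 tt] hD s s01; apply: h => //; lra.
  move=> m _; have [hD|hD] := ltP D (dot (u m) (u m)).
    have A0 : 0 < dot (u m) (u m) - D by lra.
    have [t t0 ht] := affine_threshold (2 * dot v (u m)) A0.
    by exists t => // _ s /ht; lra.
  by exists 1 => // h; move: (le_lt_trans hD h); rewrite ltxx.
have m0 : 0 < Num.min t 1 by rewrite lt_min t0 /=.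
exists (Num.min t 1) => // s l /andP[s0]; rewrite le_min => /andP[st s1] hl h.
have [hD|hD] := ltP (dot (c i + l - c j) (c i + l - c j)) D.
  have := (packingP L r c).1 pack => -[_ /(_ i j l 0 hl (hex0 z))]; rewrite addr0.
  by move=> /(_ hD).
exfalso; have v0 : 0 <= s ^+ 2 * dot v v by rewrite mulr_ge0 ?sqr_ge0 ?dot_ge0.
rewrite expand in h.
move: hD; rewrite le_eqVlt => /orP[/eqP hD|hD].
  have h1 : 0 <= 2 * s * dot v (c i + l - c j).
    by rewrite mulr_ge0 ?hw // mulr_ge0.
  lra.
have hC : dot (c i + l - c j) (c i + l - c j) < C.
  have := norm_le_sum (s%:C * v) (c i + l - c j); rewrite /C.
  have ss : s ^+ 2 * dot v v <= dot v v by rewrite ler_piMl ?dot_ge0 // expr_le1.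
  by rewrite (addrC (s%:C * v)) expand dotZl dotZr; lra.
have [m1 [m2 lE]] := hl.
have [b1 b2] : (`|m1| < B)%R /\ (`|m2| < B)%R.
  apply: hB; move: hC; rewrite lE; set l' := _ + _ * _.
  by have -> : c i + l' - c j = c i - c j + l' by ring.
have [k1 e1] := ord_int b1; have [k2 e2] := ord_int b2.
have lmE : lm (k1, k2) = l by rewrite /lm lE /= -e1 -e2.
have := ht (k1, k2); rewrite mem_enum /u lmE => /(_ isT hD s).
rewrite s0 st => /(_ isT); lra.
Qed.

Lemma line_continuous x v : continuous (fun t : R => x + t%:C * v : plane R).
Proof.
move=> t0; apply/cvgrPdist_lt => e; rewrite ltcE => /andP[/eqP e1 e0] /=.
have eE : e = (complex.Re e)%:C by case: e e1 e0 => e1 e2 /= -> _.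
rewrite eE; set E := complex.Re e in e0 *.
have N0 : 0 <= Num.sqrt (dot v v) by exact: sqrtr_ge0.
have d0 : 0 < E / (Num.sqrt (dot v v) + 1) by rewrite divr_gt0 // ltr_wpDl.
near=> t.
have -> : x + t0%:C * v - (x + t%:C * v) = (t0 - t)%:C * v by rewrite rmorphB /=; ring.
rewrite normr_dot dotZl dotZr mulrA -expr2 sqrtrM ?sqr_ge0 // sqrtr_sqr ltcR.
have : `|t0 - t| < E / (Num.sqrt (dot v v) + 1).
  by near: t; apply: cvgr_dist_lt => //; exact: cvg_id.
rewrite ltr_pdivlMr ?ltr_wpDl // mulrDr mulr1 => h.
by apply: le_lt_trans h; rewrite lerDl.
Unshelve. all: by end_near.
Qed.

(** If no edge shortens to first order, the linear motion with velocities [w] is a motion of the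
    packing for a short time, and jamming makes it a translation. *)
Lemma jammed_constant (w : 'I_n -> plane R) :
  (forall i j l, L l -> dot (c i + l - c j) (c i + l - c j) = D ->
     0 <= dot (w i - w j) (c i + l - c j)) ->
  forall i j, w i = w j.
Proof.
move=> hw i0 j0.
pose P (ij : 'I_n * 'I_n) t := forall s l, 0 <= s <= t -> L l ->
  dot (c ij.1 + l - c ij.2 + s%:C * (w ij.1 - w ij.2))
    (c ij.1 + l - c ij.2 + s%:C * (w ij.1 - w ij.2)) < D -> ij.1 = ij.2 /\ l = 0.
have [t t0 ht] : exists2 t, 0 < t & forall ij, ij \in enum {: 'I_n * 'I_n} -> P ij t.
  apply: uniform_threshold.
    by move=> ij t t' h /andP[t0 tt] s l s01; apply: h; lra.
  by move=> [i j] _; apply: pair_threshold => l; apply: hw.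
(* The velocities are scaled by the threshold [t], so that the whole unit time interval is
   admissible. *)
have [|v _ hv] := jam.2 (fun i s => c i + s%:C * (t%:C * w i)).
  split.
  - by move=> i; apply: continuous_subspaceT; apply: line_continuous.
  - by move=> i; rewrite mul0r addr0.
  - move=> s s01; apply/packingP; split; first by case: pack.
    move=> i j l l' hl hl' h.
    have := ht (i, j); rewrite mem_enum => /(_ isT (s * t) (l - l')).
    have st : 0 <= s * t <= t by rewrite mulr_ge0 ?ler_piMl //; lra.
    move=> /(_ st (hexB hl hl')) /=; case=> [|-> /eqP]; last by rewrite subr_eq0 => /eqP ->.
    move: h; set k1 := (X in dot X X < _ -> _); set k2 := (X in _ -> dot X X < _).
    by have -> : k2 = k1; first by rewrite /k1 /k2 rmorphM /=; ring.
have one : 0 <= (1 : R) <= 1 by lra.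
have tC : t%:C != 0 :> plane R.
  by apply/eqP => h; have := congr1 (@complex.Re R) h => /= h'; rewrite h' ltxx in t0.
have e i : t%:C * w i = v 1.
  by have := hv i 1 one; rewrite mul1r => /addrI.
by apply: (mulfI tC); rewrite !e.
Qed.

End Jamming.

(** * Rhombic tilings *)

Section AllRhombi.
Variables (R : realType) (r : R) (n : nat) (z : plane R).
Variable c : 'I_n -> plane R.
Implicit Types (a b d e f u v w x y p q rho : plane R) (s t : R).

Let L : set (plane R) := hex z.
Let D : R := (2 * r) ^+ 2.
Let V : set (plane R) := vertex L c.

Hypothesis z_neq0 : z != 0.
Hypothesis jam : collectively_jammed L r c.

Let pack : packing L r c := jam.1.
Let D0 : 0 < D := D_gt0 pack.
Let sep := V_sepD (vertex_sep pack).
Let LB l l' : L l -> L l' -> L (l - l') := @hexB R z l l'.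
Let LN l : L l -> L (- l) := @hexN R z l.
Let c_inj i j l := @center_inj R L r n c pack (hex0 z) i j l.
Local Notation side := (side L r c).

Lemma pigeonhole_lattice (xs : nat -> plane R) : (forall j, V (xs j)) ->
  exists i j, (i < j)%N /\ L (xs j - xs i).
Proof.
move=> hV.
have /choice[h hP] : forall j : nat, exists i, exists2 l, L l & xs j = c i + l.
  by move=> j; have [i [l hl e]] := hV j; exists i; exists l.
have [i [j [ij hij]]] : exists i j : nat, (i < j)%N /\ h i = h j.
  apply: contrapT => no.
  have inj : injective (fun i : 'I_n.+1 => h i).
    move=> i j hij; apply: val_inj; case: (ltngtP i j) => // lt; exfalso; apply: no.
      by exists i, j.
    by exists j, i; rewrite lt.
  by have := leq_card _ inj; rewrite !card_ord ltnn.
exists i, j; split => //.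
have [l hl ->] := hP i; have [l' hl' ->] := hP j; rewrite hij.
have -> : c (h j) + l' - (c (h j) + l) = l' - l by ring.
exact: LB.
Qed.

Lemma vertex_shift x l : L l -> V (x + l) -> V x.
Proof.
move=> hl vx; have := vertexD vx (LN hl); by rewrite addrK.
Qed.

Lemma side_shift x l a : L l -> side x a <-> side (x + l) a.
Proof.
have e : x + l + a = x + a + l by ring.
move=> hl; split=> -[vx va aD]; split => //; rewrite ?e.
- exact: vertexD.
- exact: vertexD.
- exact: vertex_shift vx.
- by rewrite e in va; exact: vertex_shift va.
Qed.

Hypothesis rhombi : forall x a, side x a ->
  exists b, [/\ rhomb D a b, V (x + b) & V (x + a + b)].
Hypothesis has_side : exists x a, side x a.

Definition corner x a b : Prop :=
  rhomb D a b /\ [/\ V x, V (x + a), V (x + b) & V (x + a + b)].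

Lemma corner_next x a : side x a -> exists b, corner x a b.
Proof.
move=> sa; have [b [h vb vab]] := rhombi sa; have [vx va _] := sa.
by exists b; split.
Qed.

Lemma corner_side x a b : corner x a b -> side x a /\ side x b.
Proof. by move=> [[aD bD _ _] [vx va vb _]]. Qed.

Lemma corner_rot x a b : corner x a b -> corner (x + a) b (- a).
Proof.
move=> [h [vx va vb vab]]; split; first exact: rhombN.
have -> : x + a - a = x by ring.
by have -> : x + a + b - a = x + b by ring.
Qed.

Lemma corner_shift x l a b : L l -> corner (x + l) a b -> corner x a b.
Proof.
move=> hl [h [vx va vb vab]]; split => //.
have e e' : x + l + e' = x + e' + l by ring.
rewrite -addrA in vab.
by split; apply: (vertex_shift hl); rewrite -?e // -[x + a + b]addrA -e.
Qed.

Lemma side_acute x a b : side x a -> side x b -> a != b -> dot a b <= D / 2.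
Proof.
move=> [_ va aD] [_ vb bD] /eqP ab; rewrite leNgt; apply/negP => h; apply: ab.
by apply: (sep va vb); rewrite norm_diff aD bD -/D; lra.
Qed.

(** Suppose [f = al a + be b] is another side. Its angles of at least [pi / 3] with [a] and [b] give
    [al + be >= 2]; the angle below [2 pi / 3] between [a] and [b] gives [al^2 + be^2 - al be <= 1].
    Hence [al = be = 1], which needs the angle [2 pi / 3] exactly. *)
Lemma corner_empty x a b f : corner x a b -> side x f ->
  0 <= cross a f -> 0 < cross f b -> f = a.
Proof.
move=> hc sf h1 h2; have [[aD bD X0 p] _] := hc.
have [sa sb] := corner_side hc.
apply/eqP; rewrite -[_ == _]negbK; apply/negP => fa.
have fb : f != b by apply: contraTneq h2 => ->; rewrite crossxx ltxx.
have d1 := side_acute sf sa fa; have d2 := side_acute sf sb fb.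
have Xn : cross a b != 0 by rewrite gt_eqF.
have := coordE f Xn; set al := _ / _; set be := _ / _ => fE.
have al0 : 0 < al by rewrite divr_gt0.
have be0 : 0 <= be by rewrite divr_ge0 // ltW.
have [_ _ fD] := sf; rewrite -/D in fD.
clearbody al be.
have e1 : D = al * dot f a + be * dot f b by rewrite -fD {2}fE dotDr !dotZr.
have e2 : D = al ^+ 2 * D + be ^+ 2 * D + 2 * (al * be) * dot a b.
  by rewrite -{1}fD fE !bilinE (dotC b a) aD bD; ring.
move: p; rewrite ltr_norml => /andP[p1 p2].
have h0 := D0.
have s2 : 2 <= al + be.
  have : D <= (al + be) * (D / 2) by rewrite {1}e1 mulrDl lerD // ler_wpM2l // ltW.
  by move=> k; rewrite -(ler_pM2r h0); lra.
have e3 : al * be * (- (D / 2)) <= al * be * dot a b.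
  by apply: ler_wpM2l; [rewrite mulr_ge0 // ltW|rewrite ltW].
have e4 : (al ^+ 2 + be ^+ 2 - al * be) * D <= 1 * D by rewrite mul1r {2}e2; lra.
rewrite ler_pM2r // in e4.
have h5 : (al - be) ^+ 2 <= 0 by nra.
have ab0 : al = be.
  by apply/eqP; rewrite -subr_eq0 -sqrf_eq0 eq_le h5 sqr_ge0.
have ab2 : be = 1 by apply/eqP; rewrite eq_le; apply/andP; split; nra.
have ab1 : al = 1 by rewrite ab0.
move: e2; rewrite ab1 ab2; lra.
Qed.

(** Half-open, so that a direction along an edge is counted for one of the two adjacent corners
    only. *)
Definition sector rho a b : Prop := 0 <= cross a rho /\ 0 < cross rho b.

(** If [e] lies inside the first corner, [corner_empty] applies. Otherwise the three terms of the
    Pluecker relation are nonnegative with sum zero, so [e] is [a] or [- a], and signs exclude the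
    latter. *)
Lemma sector_inj x rho a b e f : corner x a b -> corner x e f ->
  sector rho a b -> sector rho e f -> a = e.
Proof.
wlog ae : a b e f / 0 <= cross a e.
  move=> wl h1 h2 s1 s2; have [h|h] := leP 0 (cross a e); first exact: (wl a b e f).
  by apply/esym/(wl e f a b) => //; rewrite crossC oppr_ge0 ltW.
move=> h1 h2 [s1 s2] [s3 s4].
have [sa _] := corner_side h1; have [se _] := corner_side h2.
have [[aD bD X0 _] _] := h1; have [[eD fD Y0 _] _] := h2.
have [eb|eb] := ltP 0 (cross e b); first by apply/esym/(corner_empty h1).
have pl := plucker a e rho b.
rewrite (crossC rho a) in pl.
have t1 : 0 <= cross a e * cross rho b by rewrite mulr_ge0 // ltW.
have t2 : 0 <= cross e rho * cross a b by rewrite mulr_ge0 // ltW.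
have t3 : 0 <= - (cross a rho * cross e b) by rewrite -mulrN mulr_ge0 // oppr_ge0.
have z1 : cross a e * cross rho b = 0 by lra.
have z2 : cross e rho * cross a b = 0 by lra.
have ae0 : cross a e = 0.
  by move/eqP: z1; rewrite mulf_eq0 (gt_eqF s2) orbF => /eqP.
have er0 : cross e rho = 0.
  by move/eqP: z2; rewrite mulf_eq0 (gt_eqF X0) orbF => /eqP.
have [//|aNe] := pselect (a = e).
have [ea|aNe'] := pselect (a = - e); last first.
  by have := cross_neq0 aD eD aNe aNe'; rewrite ae0 eqxx.
exfalso; have ar0 : cross a rho = 0 by rewrite ea crossNl er0 oppr0.
have := plucker a rho b f; rewrite ar0 mul0r add0r {1}ea crossNl (crossC b a).
have k1 : 0 < cross rho b * cross e f by rewrite mulr_gt0.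
have k2 : 0 < cross a b * cross rho f by rewrite mulr_gt0.
lra.
Qed.

Lemma corner2_neq x a b d : corner x a b -> corner x b d -> d != a.
Proof.
move=> [[_ _ X0 _] _] [[_ _ Y0 _] _]; apply: contraTneq Y0 => ->.
by rewrite crossC oppr_gt0 -leNgt ltW.
Qed.

(** Two angles strictly between [pi / 3] and [2 pi / 3] add up to one strictly between [2 pi / 3]
    and [4 pi / 3]. *)
Lemma corner2_dot x a b d : corner x a b -> corner x b d -> dot a d < - (D / 2).
Proof.
move=> h1 h2; have [ab _] := h1; have [bd _] := h2.
have [aD bD X0] := ab; have [_ dD Y0] := bd.
rewrite !ltr_norml => /andP[q1 q2] /andP[p1 p2].
have k1 := rhomb_height D0 ab; have k2 := rhomb_height D0 bd.
have := gram b a d; rewrite bD (dotC b a) (crossC b a).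
move: (dot a b) (dot b d) (cross a b) (cross b d) (dot a d) => p q X Y u in p1 p2 q1 q2 X0 Y0 k1 k2 *.
have h0 := D0.
have XY := heights_prod D0 X0 Y0 k1 (ltW k2).
have pq : p * q < D ^+ 2 / 4 by nra.
move=> e; rewrite -(ltr_pM2l h0) e; nra.
Qed.

Lemma corner3_neq x a b d e : corner x a b -> corner x b d -> corner x d e -> e != a.
Proof.
move=> h1 h2 [[_ _ _ p] _]; apply: contraTneq p => ->.
have := corner2_dot h1 h2; rewrite dotC ltr_norml => h.
by apply/negP => /andP[h' _]; move: (lt_trans h h'); rewrite ltxx.
Qed.

Lemma corner_neq x a b : corner x a b -> b != a.
Proof. by move=> [[_ _ X0 _] _]; apply: contraTneq X0 => ->; rewrite crossxx ltxx. Qed.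

(** Three angles below [2 pi / 3] do not close up, so the first four sides met when turning are
    distinct. *)
Lemma four_sides x a : side x a -> exists b d e,
  [/\ corner x a b, corner x b d, corner x d e & uniq [:: a; b; d; e]].
Proof.
move=> sa; have [b hb] := corner_next sa; have [_ sb] := corner_side hb.
have [d hd] := corner_next sb; have [_ sd] := corner_side hd.
have [e he] := corner_next sd; exists b, d, e; split => //=.
have ne p q : p != q -> (q == p) = false by rewrite eq_sym => /negbTE.
by rewrite !inE !(ne _ _ (corner_neq hb), ne _ _ (corner2_neq hb hd),
  ne _ _ (corner3_neq hb hd he), ne _ _ (corner_neq hd), ne _ _ (corner2_neq hd he),
  ne _ _ (corner_neq he)).
Qed.

Lemma vertex_center i : V (c i).
Proof. by exists i; exists 0; [exact: hex0|rewrite addr0]. Qed.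

(** Moving exactly the centers that have an edge changes no edge, so by jamming all centers have
    one. *)
Lemma no_isolated x : V x -> exists a, side x a.
Proof.
pose w i : plane R := if `[< exists a, side (c i) a >] then 1 else 0.
have w0 i j : w i = w j.
  apply: (jammed_constant z_neq0 jam) => {}i {}j l hl hD.
  have s1 : side (c j) (c i + l - c j).
    split; first exact: vertex_center.
      by rewrite addrC subrK; apply: vertexD => //; exact: vertex_center.
    exact: hD.
  have s2 : side (c i) (- (c i + l - c j)).
    apply/(side_shift _ _ hl).
    by have := sideN s1; have -> : c j + (c i + l - c j) = c i + l by ring.
  rewrite /w !asboolT; [|by exists (c i + l - c j)|by exists (- (c i + l - c j))].
  by rewrite subrr dot0l.
move=> [j [l hl ->]]; have [y [a sa]] := has_side.
have [[i [l' hl' yE]] _ _] := sa.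
have := w0 i j; rewrite /w asboolT; last first.
  by exists a; apply/(side_shift _ _ hl'); rewrite -yE.
case: asboolP => [[b sb] _|_ /eqP]; last by rewrite oner_eq0.
by exists b; apply/(side_shift _ _ hl).1.
Qed.

(* The corners of the rhombus spanned by [e] and [e'], numbered clockwise from
   the one whose sector contains a given direction, each with its edge that has
   the rhombus on the left. *)
Definition corner_offset (q : 'I_4) (e e' : plane R) : plane R :=
  match val q with 0%N => 0 | 1%N => e' | 2%N => e + e' | _ => e end.

Definition corner_dart (q : 'I_4) (e e' : plane R) : plane R :=
  match val q with 0%N => e | 1%N => - e' | 2%N => - e | _ => e' end.

(* Every rhombus has exactly one corner whose sector contains the direction
   [rho], and at every vertex at most one corner does. *)
Lemma corner_code rho j d : rho != 0 -> side (c j) d ->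
  exists iq : 'I_n * 'I_4, exists e e' l, [/\ corner (c iq.1) e e', sector rho e e', L l,
    c j + l = c iq.1 + corner_offset iq.2 e e' & d = corner_dart iq.2 e e'].
Proof.
move=> r0 sd; have [d' h0] := corner_next sd.
have h1 := corner_rot h0; have h2 := corner_rot h1; have h3 := corner_rot h2.
have [[_ _ X0 _] _] := h0.
have nz : ~ (cross d rho = 0 /\ cross d' rho = 0).
  move=> [z1 z2]; have Xn : cross d d' != 0 by rewrite gt_eqF.
  move: r0; rewrite (coordE rho Xn) z1 (crossC rho) z2 oppr0 !mul0r.
  by rewrite addr0 eqxx.
have code y e e' : corner y e e' -> sector rho e e' -> exists i l,
    [/\ corner (c i) e e', sector rho e e', L l & y = c i + l].
  move=> hc hs; have [_ [[i [l hl yE]] _ _ _]] := hc.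
  by exists i, l; split => //; apply: (corner_shift hl); rewrite -yE.
have E1 : cross (- d) rho = - cross d rho by rewrite crossNl.
have E2 : cross (- d') rho = - cross d' rho by rewrite crossNl.
have [s0|s1|s2|s3] : [\/ sector rho d d', sector rho d' (- d),
    sector rho (- d) (- d') | sector rho (- d') d].
  rewrite /sector !crossNr !crossNl ![cross rho _]crossC !opprK.
  have [d1|d1|d1] := ltgtP 0 (cross d rho); have [d2|d2|d2] := ltgtP 0 (cross d' rho);
    try first [by constructor 1; split; lra|by constructor 2; split; lra|
               by constructor 3; split; lra|by constructor 4; split; lra|by case: nz].
- exists (j, inord 0), d, d', 0; rewrite /corner_offset /corner_dart /= inordK //.
  by split => //; exact: hex0.
- have [i [l [k1 k2 hl yE]]] := code _ _ _ h1 s1.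
  exists (i, inord 1), d', (- d), (- l); rewrite /corner_offset /corner_dart /= inordK //.
  split => //; [exact: LN| |by rewrite opprK].
  have -> : c j = c j + d - d by ring.
  by rewrite yE; ring.
- have [i [l [k1 k2 hl yE]]] := code _ _ _ h2 s2.
  exists (i, inord 2), (- d), (- d'), (- l); rewrite /corner_offset /corner_dart /= inordK //.
  split => //; [exact: LN| |by rewrite opprK].
  have -> : c j = c j + d + d' - d - d' by ring.
  by rewrite yE; ring.
- rewrite opprK in h3.
  have [i [l [k1 k2 hl yE]]] := code _ _ _ h3 s3.
  exists (i, inord 3), (- d'), d, (- l); rewrite /corner_offset /corner_dart /= inordK //.
  split => //; first exact: LN.
  have -> : c j = c j + d + d' - d - d' by ring.
  by rewrite yE; ring.
Qed.

(** At the center [i] only one corner contains [rho], so [i] determines the rhombus, and [q] then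
    selects the edge. *)
Lemma corner_code_inj rho i (q : 'I_4) j1 j2 d1 d2 :
  (exists e e' l, [/\ corner (c i) e e', sector rho e e', L l,
    c j1 + l = c i + corner_offset q e e' & d1 = corner_dart q e e']) ->
  (exists e e' l, [/\ corner (c i) e e', sector rho e e', L l,
    c j2 + l = c i + corner_offset q e e' & d2 = corner_dart q e e']) ->
  j1 = j2 /\ d1 = d2.
Proof.
move=> [e1 [f1 [l1 [k1 s1 hl1 E1 ->]]]] [e2 [f2 [l2 [k2 s2 hl2 E2 ->]]]].
have ee := sector_inj k1 k2 s1 s2; subst e2.
have ff : f1 = f2.
  have [h1 [_ _ v1 _]] := k1; have [h2 [_ _ v2 _]] := k2.
  exact: (sep v1 v2 (rhomb_close D0 h1 h2)).
subst f2; split => //; apply: (@c_inj _ _ (l2 - l1)); first exact: LB.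
have -> : c j1 = c j1 + l1 - l1 by ring.
by rewrite E1 -E2; ring.
Qed.

(** Every center has four directed edges; a fifth at one of them would give [4 n + 1], which
    [corner_code] maps injectively to [4 n] codes. *)
Lemma degree_le4 x (s : seq (plane R)) : uniq s -> (forall a, a \in s -> side x a) ->
  V x -> (size s <= 4)%N.
Proof.
move=> us hs [j0 [l0 hl0 xE]]; rewrite leqNgt; apply/negP => s5.
have /choice[S SP] : forall j, exists S, [/\ uniq S, (4 <= size S)%N,
    forall a, a \in S -> side (c j) a & j = j0 -> (5 <= size S)%N].
  move=> j; have [->|jj] := eqVneq j j0.
    exists s; split => //; first exact: ltnW.
    by move=> a /hs sa; apply/(side_shift _ _ hl0); rewrite -xE.
  have [a /four_sides[b [d [e [h1 h2 h3 u4]]]]] := no_isolated (vertex_center j).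
  exists [:: a; b; d; e]; split => //; last by move=> h; rewrite h eqxx in jj.
  have [? ?] := corner_side h1; have [? ?] := corner_side h3.
  by move=> f; rewrite !inE => /or4P[] /eqP ->.
(* The value [None] stands for the fifth edge at [j0], which has index 4. *)
pose idx (k : option ('I_n * 'I_4)) : 'I_n * nat :=
  if k is Some jm then (jm.1, nat_of_ord jm.2) else (j0, 4%N).
have idx_lt k : ((idx k).2 < size (S (idx k).1))%N.
  case: k => [[j m]|] /=; last by have [_ _ _ ->] := SP j0.
  by apply: leq_trans (ltn_ord m) _; have [] := SP j.
have idx_inj : injective idx.
  move=> [[j m]|] [[j' m']|] //=.
  - by move=> [-> /val_inj ->].
  - by move=> [_ h]; have := ltn_ord m; rewrite h ltnn.
  - by move=> [_ h]; have := ltn_ord m'; rewrite -h ltnn.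
have one0 : (1 : plane R) != 0 by exact: oner_neq0.
have dart k : side (c (idx k).1) (nth 0 (S (idx k).1) (idx k).2).
  by have [_ _ h _] := SP (idx k).1; apply: h; apply: mem_nth.
have /choice[F FP] := fun k => corner_code one0 (dart k).
have F_inj : injective F.
  move=> k k' kk'.
  have := FP k; rewrite kk' => h.
  have [jj dd] := corner_code_inj h (FP k').
  apply: idx_inj; move: dd; rewrite jj => dd.
  have lk := idx_lt k; have lk' := idx_lt k'; rewrite jj in lk.
  have [uS _ _ _] := SP (idx k').1.
  have /eqP := dd; rewrite nth_uniq // => /eqP e.
  by move: jj e; case: (idx k) => ? ?; case: (idx k') => ? ? /= -> ->.
by have := leq_card F F_inj; rewrite card_option card_prod !card_ord ltnn.
Qed.

(** The side following [e] is one of the four by the degree bound, and only [a] is left. *)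
Lemma vertex_cycle x a : side x a -> exists b d e,
  [/\ corner x a b, corner x b d, corner x d e, corner x e a &
      forall f, side x f -> f \in [:: a; b; d; e]].
Proof.
move=> sa; have [b [d [e [h1 h2 h3 u4]]]] := four_sides sa.
have [vx _ _] := sa.
have all4 f : side x f -> f \in [:: a; b; d; e].
  move=> sf; apply: contraT => fn.
  have [sa' sb] := corner_side h1; have [sd se] := corner_side h3.
  suff : (size [:: f; a; b; d; e] <= 4)%N by [].
  apply: (degree_le4 _ _ vx); first by rewrite cons_uniq fn.
  by move=> g; rewrite inE => /orP[/eqP -> //|]; rewrite !inE => /or4P[] /eqP ->.
exists b, d, e; split => //.
have [_ se] := corner_side h3; have [f h4] := corner_next se.
have [_ /all4] := corner_side h4; rewrite !inE.
rewrite (negbTE (corner_neq h4)) (negbTE (corner2_neq h3 h4)) (negbTE (corner3_neq h2 h3 h4)).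
by rewrite !orbF => /eqP fa; rewrite -fa.
Qed.

(* Moving all vertices that have both neighbours at [a] and [d] by
   [-(a + d)] shortens no edge, so a jammed packing has [a + d = 0]. *)
Lemma straight x a b d : corner x a b -> corner x b d -> d = - a.
Proof.
move=> h1 h2; have ad := corner2_dot h1 h2.
have [[aD _ _ _] [vx va _ _]] := h1; have [_ [_ vd dD']] := corner_side h2.
have dD : dot d d = D := dD'.
apply/eqP; rewrite -subr_eq0 opprK addrC; apply/eqP.
have adN : dot (a + d) (a + d) < D by rewrite norm_sum aD dD; lra.
pose W y := [/\ V y, V (y + a) & V (y + d)].
have Wshift y l : L l -> W y <-> W (y + l).
  have E f : y + l + f = y + f + l by ring.
  move=> hl; split=> -[v1 v2 v3]; rewrite ?E in v1 v2 v3 *.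
    by split; rewrite ?E; apply: vertexD.
  by split; apply: (vertex_shift hl).
have Wnext y f : W y -> side y f -> ~ W (y + f) -> f = a \/ f = d.
  move=> [vy vya vyd] sf nW; have sa : side y a by split.
  have sd : side y d by split.
  have [b' [d' [e' [k1 k2 k3 k4 all4]]]] := vertex_cycle sa.
  have hd' : d = d'.
    have := all4 _ sd; rewrite !inE => /or4P[] /eqP // e; exfalso; move: ad; rewrite e.
    - by rewrite aD => ?; have := D0; lra.
    - have [[_ _ _]] := k1; rewrite ltr_norml => /andP[? ?] _ ?; lra.
    - have [[_ _ _]] := k4; rewrite dotC ltr_norml => /andP[? ?] _ ?; lra.
  subst d'; have := all4 _ sf; rewrite !inE => /or4P[] /eqP e; [by left| |by right|].
    exfalso; apply: nW; subst f; have [_ [_ _ v1 v2]] := k1; have [_ [_ _ v3 v4]] := k2.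
    by split => //; have -> : y + b' + a = y + a + b' by ring.
  exfalso; apply: nW; subst f; have [_ [_ _ v1 v2]] := k3; have [_ [_ _ v3 v4]] := k4.
  by split => //; have -> : y + e' + d = y + d + e' by ring.
pose w i : plane R := if `[< W (c i) >] then - (a + d) else 0.
(* Both products equal [|a + d|^2 / 2]. *)
have dotf f : f = a \/ f = d -> 0 <= dot (a + d) f.
  have := dot_ge0 (a + d); rewrite norm_sum aD dD => h.
  by case=> ->; rewrite dotDl ?aD ?dD ?(dotC d a); lra.
have w_const i j : w i = w j.
  apply: (jammed_constant z_neq0 jam) => {}i {}j l hl hD.
  set f := c i + l - c j in hD *.
  have fE : c j + f = c i + l by rewrite /f; ring.
  have sf : side (c j) f.
    split; [exact: vertex_center| |exact: hD].
    by rewrite fE; apply: vertexD => //; exact: vertex_center.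
  have sNf : side (c j + f) (- f) by apply: sideN.
  rewrite /w; case: asboolP => Wi; case: asboolP => Wj; rewrite ?subrr ?dot0l //.
    rewrite subr0 dotNl -dotNr; apply: dotf.
    apply: (Wnext (c j + f)) => //; first by rewrite fE; apply/(Wshift _ _ hl).1.
    by rewrite addrK.
  rewrite sub0r opprK; apply: dotf; apply: (Wnext (c j)) => //.
  by rewrite fE => /(Wshift _ _ hl).2.
have Wx : W x by split.
have [[i [l hl xE]] _ _] := Wx; have [i' [l' hl' xaE]] := va.
have Wi : W (c i) by apply/(Wshift _ _ hl); rewrite -xE.
have := w_const i i'; rewrite /w asboolT //.
case: asboolP => [Wi' _|_ /eqP]; last by rewrite oppr_eq0 => /eqP.
(* By constancy of [w] also [x + a] moves, so [x + a + d] is a vertex, at distance less than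
   [sqrt D] from [x]. *)
have [_ _ vad] : W (x + a) by rewrite xaE; apply/(Wshift _ _ hl').1.
apply: (sep (x := x) (c := 0)); rewrite ?subr0 //; first by rewrite addrA.
by rewrite addr0.
Qed.

Lemma straight_row x a : side x a -> forall j : nat, side (x + j%:R%:C * a) a.
Proof.
move=> sa; elim=> [|j IH]; first by rewrite mul0r addr0.
have e : x + j.+1%:R%:C * a = x + j%:R%:C * a + a by rewrite -natr1 rmorphD /=; ring.
rewrite e; have sb := sideN IH.
have [b [d [_ [h1 h2 _ _ _]]]] := vertex_cycle sb.
have da := straight h1 h2; rewrite opprK in da.
by have [_] := corner_side h2; rewrite da.
Qed.

Lemma rhombi_bound : (n%:R + 1) * D < dot z z.
Proof.
have [x [a sa]] := has_side.
have [b [ab [_ _ vb _]]] := corner_next sa.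
have row := straight_row sa.
have rowV j : V (x + j%:R%:C * a) by have [] := row j.
have [i [j [ij hij]]] := pigeonhole_lattice rowV.
apply: (@row_density _ _ _ _ c D0 _ c_inj _ a b x (j - i)%N _ _ _ ab vb).
- by move=> u v vu vv; apply: (vertex_sep pack).
- move=> u f vu vf fD; have [|b' h] := @rhombi u f; first by split.
  by left; exists b'.
- by rewrite subn_gt0.
- suff -> : (j - i)%:R%:C * a = x + j%:R%:C * a - (x + i%:R%:C * a) by [].
  by rewrite natrB ?(ltnW ij) // rmorphB /=; ring.
- exact: rowV.
Qed.

End AllRhombi.

(** * A single strip of rhombi *)

Section Strip.
Variables (R : realType) (r : R) (n : nat) (z : plane R).
Variable c : 'I_n -> plane R.
Implicit Types (a b d e f v w x y p q : plane R) (s t : R) (F P Q : set (plane R)).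

Let L : set (plane R) := hex z.
Let D : R := (2 * r) ^+ 2.
Let V : set (plane R) := vertex L c.
Let support := graph_support L r c.

Hypothesis pack : packing L r c.

Let D0 : 0 < D := D_gt0 pack.
Let sep := V_sepD (vertex_sep pack).
Let LB l l' : L l -> L l' -> L (l - l') := @hexB R z l l'.
Let LN l : L l -> L (- l) := @hexN R z l.
Local Notation side := (side L r c).
Local Notation rface := (rface L r c).
Local Notation tface := (tface L r c).
Local Notation lface := (lface L r c).

Hypothesis faces : forall F, face L r c F -> rhombic_face L r c F \/ triangular_face L r c F.

Let lfaceE x a b : rface x a b -> lface x a = open_parallelogram x a b :=
  @rface_lface R L r n c pack faces x a b.

Lemma translate_parallelogram l x a b :
  translate_set l (open_parallelogram x a b) = open_parallelogram (x + l) a b.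
Proof.
apply/seteqP; split=> w.
  by move=> [w' [s [t [s01 t01 ->]]] <-]; exists s, t; split => //; ring.
move=> [s [t [s01 t01 ->]]]; exists (x + s%:C * a + t%:C * b); last by ring.
by exists s, t.
Qed.

Lemma support_shift w l : L l -> support w -> support (w + l).
Proof.
move=> hl [vw|[p [q [/(edgeP pack)[vp vq pq] [t t01 ->]]]]]; first by left; apply: vertexD.
right; exists (p + l), (q + l); split.
  apply/(edgeP pack); split; [exact: vertexD|exact: vertexD|].
  by have -> : p + l - (q + l) = p - q by ring.
by exists t => //; rewrite rmorphB /=; ring.
Qed.

Lemma rface_shift x l a b : L l -> rface x a b -> rface (x + l) a b.
Proof.
move=> hl [h [vx va vb vab] sup].
have e f : x + l + f = x + f + l by ring.
split => //.
  split; first exact: vertexD.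
  - by rewrite e; exact: vertexD.
  - by rewrite e; exact: vertexD.
  - by rewrite -addrA e addrA; exact: vertexD.
move=> w; rewrite -translate_parallelogram => -[w' hw' <-] hs.
apply: (sup _ hw'); have -> : w' = l + w' - l by ring.
by apply: support_shift => //; apply: LN.
Qed.

Lemma rface_next_inj x u a b : rface x u a -> rface x u b -> a = b.
Proof.
move=> [h1 [_ _ v1 _] _] [h2 [_ _ v2 _] _].
exact: (sep v1 v2 (rhomb_close D0 h1 h2)).
Qed.

Lemma closure_ball F x (t : R) : 0 < t -> closure F x -> exists2 w, F w & dot (w - x) (w - x) < t ^+ 2.
Proof.
move=> t0 /(_ (ball x t%:C)) []; first by apply: nbhsx_ballx; rewrite ltcR.
move=> w [Fw /(ball_dot _ _ t0) h]; exists w => //.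
by rewrite -opprB dotNl dotNr opprK.
Qed.

Lemma ball_closure F x : (forall t, 0 < t -> exists2 w, F w & dot (w - x) (w - x) < t ^+ 2) ->
  closure F x.
Proof.
move=> h B /nbhs_ballP[e /=]; rewrite ltcE => /andP[/eqP e1 e0] eB.
have eE : e = (complex.Re e)%:C by case: (e) e1 => e1 e2 /= ->.
have [w Fw hw] := h _ e0; exists w; split => //; apply: eB; rewrite eE.
by apply/ball_dot => //; rewrite -opprB dotNl dotNr opprK.
Qed.

Lemma parallelogram_closure x a b t : 0 <= t <= 1 ->
  closure (open_parallelogram x a b) (x + t%:C * a).
Proof.
move=> t01; apply: ball_closure => d d0.
(* The vector from the boundary point to the center of the parallelogram. *)
pose v := (1/2 - t)%:C * a + (1/2)%:C * b.
have N0 : 0 < dot v v + 1 by rewrite ltr_wpDl ?dot_ge0.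
pose s := Num.min (1/2) (d ^+ 2 / (dot v v + 1)).
have s0 : 0 < s by rewrite lt_min; apply/andP; split; [lra|rewrite divr_gt0 ?exprn_gt0].
have s1 : s <= 1/2 by rewrite ge_min lexx.
have s2 : s * (dot v v + 1) <= d ^+ 2.
  by rewrite -ler_pdivlMr // ge_min lexx orbT.
exists (x + t%:C * a + s%:C * v).
  have h1 : 0 <= t * (1 - s) by rewrite mulr_ge0 //; lra.
  have h2 : 0 <= (1 - t) * (1 - s) by rewrite mulr_ge0 //; lra.
  exists (t + s * (1/2 - t)), (s / 2); split; [lra|lra|].
  by rewrite /v; rewrite !(rmorphD, rmorphB, rmorphM) /=; ring.
have -> : x + t%:C * a + s%:C * v - (x + t%:C * a) = s%:C * v by ring.
clearbody v; rewrite dotZl dotZr; have := dot_ge0 v; nra.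
Qed.

Lemma common_edge_rface P Q x' a' b' p q : rface x' a' b' ->
  P = open_parallelogram x' a' b' -> common_edge L r c P Q p q ->
  side p (q - p) /\
  ((p, q - p) \in rface_edges x' a' b' \/ (p + (q - p), - (q - p)) \in rface_edges x' a' b').
Proof.
move=> rf PE [epq hcl].
have sp : side p (q - p) by apply/(side_edge pack); rewrite addrC subrK.
split => //.
have cM : closure P (p + (1/2)%:C * (q - p)).
  have [|//] := hcl (p + (1/2)%:C * (q - p)).
  by exists (1/2); [lra|rewrite rmorphB /=; ring].
(* The square of [2/5] is [4/25], just below the [3/16] required by [rface_sides]. *)
have t0 : 0 < 2 * r * (2/5) by rewrite !mulr_gt0 // ?(radius_gt0 pack) //; lra.
have [w Pw hw] := closure_ball t0 cM.
rewrite PE in Pw; apply: (rface_sides pack rf sp Pw).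
have -> : w - p - (1/2)%:C * (q - p) = w - (p + (1/2)%:C * (q - p)) by ring.
apply: lt_trans hw _; rewrite exprMn -/D.
have -> : (2/5 : R) ^+ 2 = 4 / 25 by rewrite expr2; lra.
by have := D0; lra.
Qed.

Lemma rface_edge_lface x a b (e : plane R * plane R) : rface x a b -> e \in rface_edges x a b ->
  lface e.1 e.2 = open_parallelogram x a b /\ exists d, rface e.1 e.2 d.
Proof.
move=> rf; have rf1 := rface_rot rf; have rf2 := rface_rot rf1; have rf3 := rface_rot rf2.
rewrite !inE => /or4P[] /eqP -> /=; split; try by eexists; eassumption.
- exact: lfaceE.
- by rewrite (lfaceE rf1) parallelogram_rot.
- by rewrite (lfaceE rf2) !parallelogram_rot.
- by rewrite (lfaceE rf3) !parallelogram_rot.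
Qed.

Lemma rhomb_cases a b : rhomb D a b -> [/\ a <> b, a <> - a, a <> - b & - a <> b].
Proof.
move=> [aD bD X0 _]; split=> e; move: X0.
- by rewrite e crossxx ltxx.
- have a0 : a == 0.
    have h : a + a = 0 by rewrite {2}e subrr.
    by rewrite -dot_eq0; apply/eqP; have := congr1 (dot a) h; rewrite dotDr (dotC a 0) dot0l; lra.
  by rewrite (eqP a0) crossC crossr0 oppr0 ltxx.
- by rewrite e crossNl crossxx oppr0 ltxx.
- by rewrite -e crossNr crossxx oppr0 ltxx.
Qed.

Lemma edge_position x u a p : rface x u a ->
  (p, u) \in rface_edges x u a \/ (p + u, - u) \in rface_edges x u a -> p = x \/ p = x + a.
Proof.
move=> [h _ _]; have [h1 h2 h3 h4] := rhomb_cases h.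
rewrite !inE !xpair_eqE !eqxx !andbT eqr_opp.
have -> : (u == a) = false by apply/eqP.
have -> : (u == - u) = false by apply/eqP.
have -> : (- u == u) = false by rewrite eq_sym; apply/eqP.
have -> : (u == - a) = false by apply/eqP.
have -> : (- u == a) = false by apply/eqP.
rewrite !andbF !orbF /= => -[/eqP|/eqP h']; [by left|right].
by apply: (@addIr _ u); rewrite h'; ring.
Qed.

Lemma opposite_face x u a : rface x u a -> rface (x + a + u) (- u) (- a).
Proof.
have -> : x + a + u = x + u + a by ring.
by move=> rf; apply: rface_rot; apply: rface_rot.
Qed.

Lemma opposite_lface x u a : rface x u a -> lface (x + a + u) (- u) = open_parallelogram x u a.
Proof.
move=> rf; rewrite (lfaceE (opposite_face rf)).
have -> : x + a + u = x + u + a by ring.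
by rewrite !parallelogram_rot.
Qed.

(** Only two sides of [P] are parallel to [u]. The first case is the neighbour across the side at
    [x + a], the second the one across the side at [x]. *)
Lemma adjacent_rface P Q x u a y e f p q : rface x u a -> rface y e f ->
  P = open_parallelogram x u a -> Q = open_parallelogram y e f -> P <> Q ->
  common_edge L r c P Q p q -> q - p = u \/ q - p = - u ->
  (exists2 d, rface (x + a) u d & Q = open_parallelogram (x + a) u d) \/
  (exists2 d, rface (x + u) (- u) d & Q = open_parallelogram (x + u) (- u) d).
Proof.
move=> rP rQ PE QE PQ.
wlog : p q / q - p = u.
  move=> wl ce [h|h]; first by apply: (wl p q) => //; left.
  apply: (wl q p); [by rewrite -opprB h opprK| |by left; rewrite -opprB h opprK].
  move: ce => [[vp vq pq] hcl]; split; first by split => //; rewrite distrC.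
  move=> w [t t01 ->]; apply: hcl; exists (1 - t); first by lra.
  by rewrite !rmorphB /=; ring.
move=> qpu ce _; have [sp mP] := common_edge_rface rP PE ce.
have ce' : common_edge L r c Q P p q.
  by move: ce => [h1 h2]; split => // w /h2[].
have [_ mQ] := common_edge_rface rQ QE ce'.
rewrite qpu in sp mP mQ.
have lQ : (lface p u = Q /\ exists d, rface p u d) \/
    (lface (p + u) (- u) = Q /\ exists d, rface (p + u) (- u) d).
  by rewrite QE; case: mQ => /(rface_edge_lface rQ); [left|right].
case: (edge_position rP mP) => pE; subst p.
- case: lQ => -[lQ [d rd]]; last by right; exists d => //; rewrite -lQ (lfaceE rd).
  by exfalso; apply: PQ; rewrite PE -lQ (lfaceE rP).
- case: lQ => -[lQ [d rd]]; first by left; exists d => //; rewrite -lQ (lfaceE rd).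
  by exfalso; apply: PQ; rewrite PE -lQ (opposite_lface rP).
Qed.

Variables (k : nat) (S : 'I_k -> set (plane R)) (u0 : plane R).
Hypothesis k3 : (3 <= k)%N.
Hypothesis S_rhombic : forall i, rhombic_face L r c (S i).
Hypothesis S_inj : forall i j, torus_eq L (S i) (S j) -> i = j.
Hypothesis S_adj : forall i j, i != j ->
  (exists x y, torus_common_edge L r c (S i) (S j) x y) <-> (j = ordS i \/ i = ordS j).
Hypothesis S_dir : forall i x y, torus_common_edge L r c (S i) (S (ordS i)) x y ->
  y - x = u0 \/ y - x = - u0.
Hypothesis S_all : forall F, rhombic_face L r c F -> exists i, torus_eq L F (S i).

Lemma rface_rhombic x a b : rface x a b -> rhombic_face L r c (open_parallelogram x a b).
Proof.
move=> rf; have sa := rface_side rf; have rf1 := rface_rot rf; have rf2 := rface_rot rf1.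
have rf3 := rface_rot rf2.
split; first by rewrite -(lfaceE rf); apply: lface_face.
exists x, a, b; split => //.
- exact/(side_edge pack).
- have := sideN (rface_side rf3); rewrite opprK => /(side_edge pack).
  have -> : x + a + b - a - b = x by ring.
  by [].
- by apply/(side_edge pack); exact: (rface_side rf1).
- have := sideN (rface_side rf2); rewrite opprK => /(side_edge pack).
  have -> : x + a + b - a = x + b by ring.
  by have -> : x + b + a = x + a + b by ring.
Qed.

Lemma ordS_neq (i : 'I_k) : i != ordS i.
Proof.
apply/eqP => /(congr1 val) /=; have := ltn_ord i; rewrite leq_eqVlt => /orP[/eqP e|lt].
  by rewrite e modnn => i0; move: k3; rewrite -e i0.
by rewrite modn_small // => /eqP; rewrite ltn_eqF.
Qed.

(** Here [3 <= k] keeps the two neighbours of a rhombus apart. *)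
Lemma ordSS_neq (i : 'I_k) : i != ordS (ordS i).
Proof.
apply/eqP => /(congr1 val) /=; have := ltn_ord i; rewrite leq_eqVlt => /orP[/eqP e|lt].
  by rewrite e modnn modn_small => [i0|]; [move: k3; rewrite -e i0|exact: ltnW].
rewrite (modn_small lt); move: (lt); rewrite leq_eqVlt => /orP[/eqP e|lt'].
  by rewrite e modnn => i0; move: k3; rewrite -e i0.
by rewrite modn_small // => /eqP; rewrite ltn_eqF // ltnW.
Qed.

Lemma translate0 F : translate_set 0 F = F.
Proof.
apply/seteqP; split=> w; first by move=> [w' h <-]; rewrite add0r.
by exists w; rewrite ?add0r.
Qed.

Lemma translateD l l' F : translate_set l (translate_set l' F) = translate_set (l + l') F.
Proof.
apply/seteqP; split=> w.
  by move=> [w' [w'' h <-] <-]; exists w'' => //; rewrite addrA.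
by move=> [w' h <-]; exists (l' + w'); rewrite ?addrA //; exists w'.
Qed.

Lemma strip_lift x a b : rface x a b -> exists i l,
  [/\ L l, open_parallelogram x a b = translate_set l (S i),
      S i = open_parallelogram (x - l) a b & rface (x - l) a b].
Proof.
move=> rf; have [i [l hl e]] := S_all (rface_rhombic rf).
exists i, l; split => //; last by apply: rface_shift => //; apply: LN.
by rewrite -translate_parallelogram e translateD addNr translate0.
Qed.

(** Predecessor and successor both meet the rhombus in sides parallel to [u0]. If neither lay across
    the side at [x + a], both would be the face across the opposite side, against [ordSS_neq]. *)
Lemma strip_step x a : rface x u0 a -> exists d, rface (x + a) u0 d.
Proof.
move=> /strip_lift[i [l [hl _ SE rf]]]; set x0 := x - l in SE rf.
suff [d rd] : exists d, rface (x0 + a) u0 d.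
  exists d; have := rface_shift hl rd.
  by have -> : x0 + a + l = x + a by rewrite /x0; ring.
have toQ l1 (m : 'I_k) : L l1 -> exists y e f, rface y e f /\
    translate_set l1 (S m) = open_parallelogram y e f.
  move=> hl1; have [y [e [f [ry ->]]]] := rhombic_rface pack (S_rhombic m).
  by exists (y + l1), e, f; rewrite translate_parallelogram; split => //; apply: rface_shift.
have [|p [q pq]] := (S_adj (ordS_neq i)).2; first by left.
have dir := S_dir pq; have [l1 hl1 ce] := pq.
have [y [e [f [ry QE]]]] := toQ l1 (ordS i) hl1.
have PQ : S i <> translate_set l1 (S (ordS i)).
  by move=> h; have /eqP := ordS_neq i; apply; apply: S_inj; exists l1.
case: (adjacent_rface rf ry SE QE PQ ce dir) => [[d rd _]|[d1 rd1 Q1]]; first by exists d.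
pose j := ord_pred i; have ji : ordS j = i by apply: ord_predK.
have [|p' [q' pq']] := (S_adj (ordS_neq j)).2; first by left.
have dir' := S_dir pq'; rewrite ji in pq'; have [l2 hl2 [epq hcl]] := pq'.
have ce' : common_edge L r c (translate_set l2 (S i)) (S j) p' q'.
  by split => // w /hcl[].
have [y' [e' [f' [ry' QE']]]] := toQ 0 j (hex0 z); rewrite translate0 in QE'.
have PQ' : translate_set l2 (S i) <> S j.
  move=> h; have /eqP := ordS_neq j; apply; rewrite ji; apply: S_inj.
  by exists l2.
have PE' : translate_set l2 (S i) = open_parallelogram (x0 + l2) u0 a.
  by rewrite SE translate_parallelogram.
case: (adjacent_rface (rface_shift hl2 rf) ry' PE' QE' PQ' ce' dir') => [[d rd _]|[d2 rd2 Q2]].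
  exists d; have := rface_shift (LN hl2) rd.
  by have -> : x0 + l2 + a - l2 = x0 + a by ring.
exfalso; have := rface_shift hl2 rd1.
have E : x0 + u0 + l2 = x0 + l2 + u0 by ring.
rewrite E => /(rface_next_inj rd2) dd; subst d1.
have /eqP := ordSS_neq j; apply; rewrite ji; apply: S_inj.
exists (l2 + l1); first exact: hexD.
by rewrite -translateD Q1 Q2 translate_parallelogram E.
Qed.

Lemma common_edge_intro x u a b : rface x u a -> rface x a b ->
  common_edge L r c (open_parallelogram x u a) (open_parallelogram x a b) x (x + a).
Proof.
move=> r1 r2; split; first exact/(side_edge pack)/(rface_side r2).
move=> w [t t01 ->].
have -> : (1 - t)%:C * x + t%:C * (x + a) = x + t%:C * a by rewrite rmorphB /=; ring.
split; last exact: parallelogram_closure.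
have -> : open_parallelogram x u a = open_parallelogram (x + a) (- a) u.
  rewrite -(parallelogram_rot x u) -(parallelogram_rot (x + u) a).
  by rewrite -(parallelogram_rot (x + u + a) (- u)) opprK; congr (open_parallelogram _ _ _); ring.
have -> : x + t%:C * a = x + a + (1 - t)%:C * (- a) by rewrite rmorphB /=; ring.
by apply: parallelogram_closure; lra.
Qed.

(** A rhombus to the left of [a] would belong to the strip. A different member would share an edge
    not parallel to [u0]; a translate of the same member would be its translate by [- u0], making
    [u0] a lattice vector. *)
Lemma strip_left x a : rface x u0 a -> ~ L u0 -> exists b, tface x a b.
Proof.
move=> rP nL.
have rP3 := rface_rot (rface_rot (rface_rot rP)).
have sa : side x a.
  have := sideN (rface_side rP3); rewrite opprK.
  by have -> : x + u0 + a - u0 - a = x by ring.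
have [_ _ aD] := sa.
case: (lface_cases pack faces sa) => -[b [rQ QE]]; last by exists b.
exfalso; have [[uD _ X0 _] _ _] := rP.
have mQ := lface_mleft pack sa; rewrite QE in mQ.
have PQ : open_parallelogram x u0 a <> open_parallelogram x a b.
  move=> e; move: mQ; rewrite -e => /(parallelogramP _ _ X0)[/andP[h _] _].
  by move: h; rewrite crossC mleft_cross aD -/D; have := D0; lra.
have [h1 h2 h3 h4] := rhomb_cases (let: And3 h _ _ := rP in h).
have [i [l [hl PS SE _]]] := strip_lift rP; have [j [l' [hl' QS SE' _]]] := strip_lift rQ.
have [ij|ij] := eqVneq i j.
  subst j; pose m := l' - l; have hm : L m by apply: LB.
  have QE' : open_parallelogram x a b = open_parallelogram (x + m) u0 a.
    by rewrite QS SE translate_parallelogram; congr (open_parallelogram _ _ _); rewrite /m; ring.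
  rewrite QE' in mQ.
  have := rface_sides pack (rface_shift hm rP) sa mQ (mleft_dist pack x aD).
  rewrite !inE !xpair_eqE !eqxx !andbT eqr_opp.
  have -> : (a == u0) = false by apply/eqP => e; apply: h1.
  have -> : (a == - u0) = false by apply/eqP => e; apply: h4.
  have -> : (a == - a) = false.
    apply/eqP => e; have := congr1 (dot a) e; rewrite dotNr aD -/D.
    by have := D0; lra.
  have -> : (- a == u0) = false by apply/eqP => e; apply: h3.
  have -> : (- a == a) = false.
    apply/eqP => e; have := congr1 (dot a) e; rewrite dotNr aD -/D.
    by have := D0; lra.
  rewrite !andbF !orbF /= => -[/eqP e|/eqP e].
    apply: nL; have -> : u0 = (x + m + u0) - x - m by ring.
    by rewrite -e subrr sub0r; apply: LN.
  apply: PQ; rewrite QE'; suff -> : m = 0 by rewrite addr0.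
  have -> : m = (x + m + u0 + a - u0) - (x + a) by ring.
  by rewrite -e subrr.
have rPl := rface_shift (LN hl) rP; have rQl := rface_shift (LN hl) rQ.
have tij : torus_common_edge L r c (S i) (S j) (x - l) (x - l + a).
  exists (l' - l); first exact: LB.
  rewrite SE SE' translate_parallelogram.
  have -> : x - l' + (l' - l) = x - l by ring.
  exact: common_edge_intro.
have rPl' := rface_shift (LN hl') rP; have rQl' := rface_shift (LN hl') rQ.
have tji : torus_common_edge L r c (S j) (S i) (x - l') (x - l' + a).
  exists (l - l'); first exact: LB.
  rewrite SE SE' translate_parallelogram.
  have -> : x - l + (l - l') = x - l' by ring.
  by have [? h] := common_edge_intro rPl' rQl'; split => // w /h[].
have bad y : y + a - y = u0 \/ y + a - y = - u0 -> False.
  have -> : y + a - y = a by ring.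
  by case=> e; [apply: h1|apply: h4].
case: ((S_adj ij).1 _) => [|e|e]; first by exists (x - l), (x - l + a).
- by subst j; apply: bad (S_dir tij).
- by subst i; apply: bad (S_dir tji).
Qed.

(** At a left turn by [theta] the two triangles leave the angle [pi / 3 - theta] between [b'] and
    [b - a]. These sides then coincide and [theta = pi / 3], whereas [acute_angle], applied to two
    rhombi sharing a side, gives [theta < pi / 3]. *)
Lemma triangles_turn x a b a' b' : rface x u0 a -> tface x a b ->
  rface (x + a) u0 a' -> tface (x + a) a' b' -> cross a a' <= 0.
Proof.
move=> [hu _ _] [tb [_ _ vb] _] [hu' _ _] [tb' [_ _ vb'] _].
have [_ aD X0 p] := hu; have [uD aD' X0' p'] := hu'.
have CD := acute_angle D0 uD aD aD' X0 X0' p (ltW p').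
have [_ bD Y0 pb] := tb; have [_ bD' Y0' pb'] := tb'.
have [tD _ _] := trigon_turn tb.
rewrite leNgt; apply/negP => S0.
have Y2 : cross a b ^+ 2 = 3 / 4 * D ^+ 2 := trigon_height tb.
have Y2' : cross a' b' ^+ 2 = 3 / 4 * D ^+ 2 := trigon_height tb'.
have YY : cross a' b' = cross a b.
  have := etrans Y2' (esym Y2); move/eqP; rewrite eqf_sqr => /orP[/eqP //|/eqP]; lra.
have g1 := gram a' a b'; have g2 := gram_cross a' a b'.
have g3 := gram a b' (b - a); have g4 := lagrange a a'.
move: g1 g2 g3 g4; rewrite (dotC a' a) (crossC a' a) !aD !aD' !pb' !YY -/D.
have -> : dot a (b - a) = - (D / 2) by have [_ _ ->] := trigon_turn tb.
have -> : cross a (b - a) = cross a b by have [_ -> _] := trigon_turn tb.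
set T := dot b' (b - a).
move: (dot a a') (cross a a') (cross a b) (dot a b') (cross a b') CD S0 Y0 Y2.
move=> C S1 Y m1 m2 CD S0 Y0 Y2 g1 g2 g3 g4.
have h0 := D0.
(* The cosine of [pi / 3 - theta], where [C / D] and [S1 / D] are the cosine and sine of [theta] and
   [Y / D] is the sine of [pi / 3]. *)
have TE : D * T = C * D / 2 + S1 * Y.
  apply: (mulfI (lt0r_neq0 D0)); transitivity ((D * m1) * (- (D / 2)) + (D * m2) * Y).
    by rewrite g3; ring.
  rewrite g1 g2; have -> : (C * Y - - S1 * (D / 2)) * Y = C * Y ^+ 2 + S1 * D / 2 * Y by field.
  by rewrite Y2; field.
have Yb : D / 2 < Y by nra.
have CS : D < C + S1 by nra.
have T1 : D / 2 < T.
  rewrite -(ltr_pM2l D0) TE.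
  have : S1 * (D / 2) < S1 * Y by rewrite ltr_pM2l.
  nra.
have vb2 : V (x + a + (b - a)) by have -> : x + a + (b - a) = x + b by ring.
have e : b' = b - a.
  apply: (sep vb' vb2); rewrite norm_diff bD' tD -/D -/T; lra.
have T2 : T = D by rewrite /T e tD.
have sq : (C * D / 2 + S1 * Y) ^+ 2 + (C * Y - S1 * D / 2) ^+ 2 = (C ^+ 2 + S1 ^+ 2) * (D ^+ 2 / 4 + Y ^+ 2).
  by field.
move: sq; rewrite -TE T2 Y2 -g4 => sq.
have : (C * Y - S1 * D / 2) ^+ 2 = 0 by nra.
move/eqP; rewrite sqrf_eq0 subr_eq0 => /eqP CY.
have h : D ^+ 2 * S1 ^+ 2 = D ^+ 2 * (3 * C ^+ 2).
  have : (C * Y) ^+ 2 = (S1 * D / 2) ^+ 2 by rewrite CY.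
  have -> : (S1 * D / 2) ^+ 2 = D ^+ 2 * S1 ^+ 2 / 4 by field.
  by rewrite exprMn Y2; lra.
have D2 : D ^+ 2 != 0 by rewrite sqrf_eq0 lt0r_neq0.
move/(mulfI D2): h => h.
nra.
Qed.

(** The quotient is the cotangent of the angle from [u], which is injective between 0 and [pi]. *)
Lemma cot_inj u a b : rhomb D u a -> rhomb D u b ->
  dot u a / cross u a = dot u b / cross u b -> a = b.
Proof.
move=> [uD aD X _] [_ bD Y _] /eqP; rewrite eqr_div ?lt0r_neq0 // => /eqP h.
have g := gram_cross u a b; rewrite h [cross u a * _]mulrC subrr in g.
move/eqP: g; rewrite mulf_eq0 uD (gt_eqF D0) /= => /eqP ab.
have [//|anb] := pselect (a = b).
have [aNb|aNb] := pselect (a = - b).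
  by move: X; rewrite aNb crossNr oppr_gt0 => X; move: (lt_trans X Y); rewrite ltxx.
by have := cross_neq0 aD bD anb aNb; rewrite ab eqxx.
Qed.

Lemma strip_bound x a : rface x u0 a -> (n%:R + 1) * D < dot z z.
Proof.
move=> rx.
have c_inj i j l : hex z l -> c i = c j + l -> i = j by apply: (center_inj pack (hex0 z)).
have vsep x' y : V x' -> V y -> dot (x' - y) (x' - y) < D -> x' = y by apply: (vertex_sep pack).
have vleft x' a' : V x' -> V (x' + a') -> dot a' a' = D -> _ := @vertex_left R L r n c pack faces x' a'.
have /choice[A AP] : forall y, exists d, (exists d', rface y u0 d') -> rface y u0 d.
  move=> y; have [[d rd]|nd] := pselect (exists d', rface y u0 d'); first by exists d.
  by exists 0.
have [hu|nu] := pselect (L u0).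
  have [ua [vx _ va _] _] := rx.
  apply: (row_density D0 vsep c_inj vleft (K := 1) _ _ _ ua va) => //.
    by rewrite mul1r.
  by move=> j; apply: vertexD => //; apply: (hexMz j hu).
pose xs j := iter j (fun y => y + A y) x.
have rxs j : rface (xs j) u0 (A (xs j)).
  elim: j => [|j IH]; apply: AP; first by exists a.
  exact: strip_step.
have rxsV (t : nat) : V (xs t) by have [_ []] := rxs t.
have [i [j [ij hij]]] := pigeonhole_lattice rxsV.
have xsS (t : nat) : xs t.+1 = xs t + A (xs t) by [].
(* Cotangents turn the one-sided bending into monotonicity; equal values one period apart then make
   [h] constant in between. *)
pose h (t : nat) := dot u0 (A (xs t)) / cross u0 (A (xs t)).
have rh (t : nat) : rhomb D u0 (A (xs t)) by have [] := rxs t.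
have h_mono : {homo h : m t / (m <= t)%N >-> m <= t}.
  apply: homo_leq => [//|y w v|t]; first exact: le_trans.
  have [b tb] := strip_left (rxs t) nu; have [b' tb'] := strip_left (rxs t.+1) nu.
  have := triangles_turn (rxs t) tb (rxs t.+1) tb'.
  have [uD _ X _] := rh t; have [_ _ X' _] := rh t.+1.
  rewrite -(pmulr_rle0 _ D0) -uD gram_cross subr_le0 => hh.
  by rewrite /h ler_pdivrMr // mulrAC ler_pdivlMr // [X in _ <= X]mulrC.
have Aij : A (xs j) = A (xs i).
  apply: (rface_next_inj (rxs j)); have := rface_shift hij (rxs i).
  by rewrite addrC subrK.
clear a rx; set a := A (xs i) in Aij.
have Aa m : (i <= m <= j)%N -> A (xs m) = a.
  move=> /andP[im mj]; apply: (cot_inj (rh m) (rh i)); rewrite -/(h m) -/(h i).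
  apply: le_anti; rewrite (h_mono _ _ im) andbT.
  by have := h_mono _ _ mj; rewrite {2}/h Aij.
have xa (t : nat) : (t <= j - i)%N -> xs (i + t)%N = xs i + t%:R%:C * a.
  elim: t => [|t IH] ht; first by rewrite addn0 mul0r addr0.
  rewrite addnS xsS IH ?(ltnW ht) // -IH ?(ltnW ht) // Aa; last by lia.
  by rewrite IH ?(ltnW ht) // -natr1 rmorphD /=; ring.
have Ka : L ((j - i)%:R%:C * a).
  have := xa _ (leqnn _); rewrite subnKC ?(ltnW ij) // => e.
  suff -> : (j - i)%:R%:C * a = xs j - xs i by [].
  by rewrite e; ring.
have K0 : (0 < j - i)%N by rewrite subn_gt0.
have [ua [vx vu _ _] _] := rxs i.
(* The row is the border of the strip at [u0]: the rhombi are to the left of it, with second side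
   [- u0]. *)
apply: (row_density D0 vsep c_inj vleft (x := xs i + u0) K0 Ka _ (rhombN ua)).
  move=> t; rewrite (divn_eq t (j - i)) natrD natrM rmorphD rmorphM /=.
  have lt : (t %% (j - i) < j - i)%N by rewrite ltn_mod.
  have [_ [_ vu' _ _] _] := rxs (i + t %% (j - i))%N.
  have := vertexD vu' (hexMz (t %/ (j - i))%N Ka); rewrite xa ?(ltnW lt) //.
  set v := _ + _ + _ + _; set w := _ + _; suff -> : v = w by [].
  by rewrite /v /w; ring.
by have -> : xs i + u0 - u0 = xs i by ring.
Qed.

End Strip.

(** * From the vertex count to the density *)

Section Conclusion.
Variables (R : realType) (z : plane R) (n : nat) (r : R) (c : 'I_n -> plane R).
Hypothesis z_neq0 : z != 0.
Hypothesis jam : collectively_jammed (hex z) r c.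

Let pack : packing (hex z) r c := jam.1.
Let D : R := (2 * r) ^+ 2.

(** With [s = sqrt 3 / 2] the torus has area [s * |z|^2] and [sqrt 12 = 4 s]; clearing denominators
    leaves the common positive factor [n * pi * s]. *)
Lemma density_bound : (0 < n)%N -> (n%:R + 1) * D < dot z z ->
  density z (gDelta R * z) r n < n%:R / (n%:R + 1) * (pi / Num.sqrt 12).
Proof.
move=> n0 h; have [_ s0 s2] := gDeltaE R; have zz := dot_ge0 z.
rewrite /density /torus_area -/(cross z (gDelta R * z)) cross_gDelta.
set s := complex.Im _ in s0 s2 *.
have r0 := radius_gt0 pack; have n0' : 0 < n%:R :> R by rewrite ltr0n.
have Dpos : 0 < (n%:R + 1) * D by rewrite mulr_gt0 ?(D_gt0 pack) // ltr_wpDl // ltW.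
have z0 : 0 < dot z z by apply: lt_trans h.
have -> : Num.sqrt 12 = 4 * s :> R.
  have -> : (12 : R) = (4 * s) ^+ 2 by rewrite exprMn s2 expr2; lra.
  by rewrite sqrtr_sqr ger0_norm // mulr_ge0 // ltW.
rewrite ger0_norm; last by rewrite mulr_ge0 // ltW.
have pi0 := pi_gt0 R.
rewrite mulf_div ltr_pdivrMr ?mulr_gt0 // [X in _ < X]mulrAC ltr_pdivlMr; last first.
  by rewrite !mulr_gt0 // ltr_wpDl // ltW.
have -> : n%:R * pi * r ^+ 2 * ((n%:R + 1) * (4 * s)) = n%:R * pi * s * ((n%:R + 1) * D).
  by rewrite /D exprMn expr2; ring.
have -> : n%:R * pi * (s * dot z z) = n%:R * pi * s * dot z z by ring.
by rewrite ltr_pM2l // !mulr_gt0.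
Qed.

Lemma all_rhombi_bound : ~ all_triangles (hex z) r c -> all_rhombi (hex z) r c ->
  (n%:R + 1) * D < dot z z.
Proof.
move=> ntri rho; apply: (rhombi_bound z_neq0 jam).
  move=> x a sa; have [b [[h [_ _ vb vab] _] _]] := lface_rhombic pack sa (rho _ (lface_face pack sa)).
  by exists b.
apply: contrapT => no; apply: ntri => F /rho/(rhombic_rface pack)[x [a [b [rf _]]]].
by case: no; exists x, a; apply: rface_side rf.
Qed.

Lemma single_strip_bound : single_strip_and_triangles (hex z) r c ->
  (n%:R + 1) * D < dot z z.
Proof.
move=> [[k [S [[k3 S_rh S_inj S_adj [u _ S_u]] S_all]]] faces].
have edgeD p q : edge (hex z) r c p q -> dot (q - p) (q - p) = D.
  by move=> /(edgeP pack)[_ _ h]; rewrite -[RHS]h -[q - p]opprB dotNl dotNr opprK.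
pose i0 : 'I_k := Ordinal (leq_trans (isT : (0 < 3)%N) k3).
have [|p [q pq]] := (S_adj _ _ (ordS_neq k3 i0)).2; first by left.
pose u0 := q - p.
have [l _ ce] := pq; have u0D := edgeD _ _ ce.1; rewrite -/u0 in u0D.
(* All edges have the same length, so parallel edge vectors differ at most by a sign. *)
have S_dir i x y : torus_common_edge (hex z) r c (S i) (S (ordS i)) x y ->
    y - x = u0 \/ y - x = - u0.
  move=> h; have [l' _ ce'] := h; have yxD := edgeD _ _ ce'.1.
  have [t yx] := S_u _ _ _ h; have [t0 qp] := S_u _ _ _ pq.
  have [e|ne] := pselect (y - x = u0); first by left.
  have [e|ne'] := pselect (y - x = - u0); first by right.
  have := cross_neq0 yxD u0D ne ne'.
  by rewrite yx /u0 qp crossZl crossZr crossxx !mulr0 eqxx.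
have [y [e [f [ry SE]]]] := rhombic_rface pack (S_rh i0).
have [_ mem] := common_edge_rface pack ry SE ce; rewrite -/u0 in mem.
have [x [a rx]] : exists x a, rface (hex z) r c x u0 a.
  case: mem => /(rface_edge_lface pack faces ry)[_ [d rd]]; first by exists p, d.
  have := opposite_face rd; rewrite /= opprK => rd'.
  by eexists _, _; exact: rd'.
exact: (strip_bound pack faces k3 S_rh S_inj S_adj S_dir S_all rx).
Qed.

(** For [n = 0] both sides of the density bound are zero. But without vertices no face is rhombic,
    and [all_triangles] would hold. *)
Lemma centers_exist : ~ all_triangles (hex z) r c ->
  all_rhombi (hex z) r c \/ single_strip_and_triangles (hex z) r c -> (0 < n)%N.
Proof.
move=> ntri h; rewrite lt0n; apply/negP => /eqP n0; apply: ntri => F hF.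
have noV x : ~ vertex (hex z) c x by move=> [[i ni] _]; move: ni; rewrite n0.
have [hr|[_ /(_ F hF)[hr|//]]] := h.
  have [x [a [b [[_ [vx _ _ _] _] _]]]] := rhombic_rface pack (hr F hF).
  by case: (noV x).
have [x [a [b [[_ [vx _ _ _] _] _]]]] := rhombic_rface pack hr.
by case: (noV x).
Qed.

End Conclusion.

Theorem theorem4 (R : realType) (z : plane R) (n : nat) (r : R)
    (c : 'I_n -> plane R) :
  z != 0 ->
  let L := lattice z (gDelta R * z) in
  collectively_jammed L r c ->
  ~ all_triangles L r c ->
  all_rhombi L r c \/ single_strip_and_triangles L r c ->
  density z (gDelta R * z) r n < n%:R / (n%:R + 1) * (pi / Num.sqrt 12).
Proof.
move=> z0 L jam ntri h.
apply: (density_bound jam); first exact: (centers_exist jam ntri h).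
by case: h => [/(all_rhombi_bound z0 jam ntri)|/(single_strip_bound jam)].
Qed.
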